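(* Let $\mu^0$ and $\mu^{\mathcal T}$ be probability measures on $[0,t_f]$, let $r>0$ and $w(v_0,v_1),w(v_1,v_2)>0$, and consider the problem of determining $\pi\in\mathcal M_+([0,t_f]^3)$ that minimizes $$\iiint_{t_0,t_1,t_2} c(t_0,t_1,t_2)\,\pi(dt_0,dt_1,dt_2),\qquad c(t_0,t_1,t_2)=\frac{w(v_0,v_1)}{t_1-t_0}+\frac{w(v_1,v_2)}{t_2-t_1},$$ subject to $$\iint_{t_1,t_2}\pi=\mu^0(t_0),\qquad \iint_{t_0,t_1}\pi=\mu^{\mathcal T}(t_2),\qquad \iint_{t_0,t_2}\pi=:\sigma^1(dt_1)\le r\,dt_1 .$$ Then the minimizer is unique. Moreover, there exist functions $T^{\mathcal D}(t_1)$ and $T^{\mathcal A}(t_1)$ that are monotonically non-increasing such that $$\pi=\big(T^{\mathcal D},\mathrm{Id},T^{\mathcal A}\big)_{\sharp}\sigma,$$ where $\mathrm{Id}(t_1)=t_1$ is the identity map, and $\sigma(t_1)\,dt_1$ is an absolutely continuous measure on $[0,t_f]$ satisfying $\sigma(t_1)\le r$.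
   Context: $t_f>0$ is the time horizon and $\mathcal M_+([0,t_f]^3)$ is the set of nonnegative measures on $[0,t_f]^3$. The coordinates $t_0,t_1,t_2$ are the times at which mass departs from the source $v_0$, crosses the intermediate node $v_1$, and arrives at the sink $v_2$; $w(v_0,v_1)$ and $w(v_1,v_2)$ are the weights of the two edges, and $r$ is the flow-rate bound at $v_1$. The formula for $c$ is used for ordered times $t_0<t_1<t_2$, and $c=+\infty$ otherwise. $(T^{\mathcal D},\mathrm{Id},T^{\mathcal A})_{\sharp}\sigma$ is the push-forward of $\sigma(t_1)\,dt_1$ under $t_1\mapsto(T^{\mathcal D}(t_1),t_1,T^{\mathcal A}(t_1))$; here $\sigma$ is the density of the $t_1$-marginal $\sigma^1$ of $\pi$.
   Formalization: The maps T^D and T^A are proved monotonically non-decreasing, since ''non-increasing'' is false for this cost (e.g. μ^0 with two atoms), and a feasible π of finite cost is assumed to exist, without which the minimizer may fail to exist or be unique. *)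

(* Defs.v *)
From HB Require Import structures.
From mathcomp Require Import all_boot all_order all_algebra.
From mathcomp Require Import all_classical all_reals all_analysis.

Set Implicit Arguments.
Unset Strict Implicit.
Unset Printing Implicit Defensive.
Import Order.TTheory GRing.Theory Num.Theory.

Local Open Scope classical_set_scope.
Local Open Scope ring_scope.

(* A point ((t0, t1), t2) lists the departure, crossing and arrival times. *)
Notation times R :=
  ((measurableTypeR R * measurableTypeR R) * measurableTypeR R)%type.

Section toll_station.
Context {R : realType}.
Implicit Types (x : times R) (pi : {measure set (times R) -> \bar R}).

Definition t0_of x : measurableTypeR R := x.1.1.
Definition t1_of x : measurableTypeR R := x.1.2.
Definition t2_of x : measurableTypeR R := x.2.

Definition cube (tf : R) : set (times R) :=
  [set x | [/\ t0_of x \in `[0, tf], t1_of x \in `[0, tf]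
             & t2_of x \in `[0, tf]]].

Definition cost (w01 w12 : R) x : \bar R :=
  if (t0_of x < t1_of x) && (t1_of x < t2_of x) then
    (w01 / (t1_of x - t0_of x) + w12 / (t2_of x - t1_of x))%:E
  else +oo%E.

Definition total_cost (w01 w12 : R) pi : \bar R :=
  (\int[pi]_x cost w01 w12 x)%E.

(* Measures on [0, tf]^3 are the Borel measures on the ambient space R^3
   that vanish outside the cube.  Finiteness is implied by the marginals. *)
Definition feasible (tf r : R) (mu0 muT : probability (measurableTypeR R) R)
    pi : Prop :=
  [/\ pi (~` cube tf) = 0%E,
      forall A, measurable A -> pushforward pi t0_of A = mu0 A,
      forall A, measurable A -> pushforward pi t2_of A = muT A
    & forall A, measurable A ->
        (pushforward pi t1_of A <= r%:E * lebesgue_measure A)%E].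

Definition minimizer (tf r w01 w12 : R)
    (mu0 muT : probability (measurableTypeR R) R) pi : Prop :=
  feasible tf r mu0 muT pi /\
  forall pi', feasible tf r mu0 muT pi' ->
    (total_cost w01 w12 pi <= total_cost w01 w12 pi')%E.

(* The measure sigma(t) dt on [0, tf], extended by 0 to the line. *)
Definition density_measure (tf : R) (sigma : R -> R) :
    set (measurableTypeR R) -> \bar R :=
  fun A => (\int[lebesgue_measure]_(t in `[0%R, tf] `&` A) (sigma t)%:E)%E.

(* The maps are only constrained on [0, tf]; density_measure ignores the rest. *)
Definition through (TD TA : R -> R) (t : measurableTypeR R) : times R :=
  ((TD t, t), TA t).

End toll_station.

(* Main.v *)
(** For a fixed crossing law sigma the cost splits into a departure and an
    arrival part, each a transport problem with a convex cost of t1 - t0 or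
    t2 - t1; its optimal plan is the monotone rearrangement.  Indeed
    w / (z - y) is the integral over v >= z of w / (v - y)^2, so by Tonelli
    the cost of a plan is an integral over v of integrals of an increasing
    function of y over the event {z <= v}, whose probability is prescribed:
    each is least when this event is a lower set in y (bathtub principle).
    It remains to optimise over sigma, that is over its quantile function q.
    The bound sigma <= r dt reads q(s') - q(s) >= (s' - s) / r, a condition
    that is convex and stable under min and max.  As a functional of q the
    cost is modular, J(min(q,q')) + J(max(q,q')) = J(q) + J(q'), so running
    minima of a fast minimising sequence are again minimising, and two
    monotone limits with Fatou's lemma give a minimiser.  Strict convexity of 1/x gives
    uniqueness. *)

Require Import Defs.
From HB Require Import structures.
From mathcomp Require Import all_boot all_order all_algebra.
From mathcomp Require Import all_classical all_reals all_analysis.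
From mathcomp Require Import measurable_realfun.
From mathcomp Require Import ring lra.

Set Implicit Arguments.
Unset Strict Implicit.
Unset Printing Implicit Defensive.
Import Order.TTheory GRing.Theory Num.Theory.
Import numFieldNormedType.Exports.

Local Open Scope classical_set_scope.
Local Open Scope ring_scope.

(** * Cost of a single edge and its decomposition into layers *)

Section travel_cost.
Context {R : realType}.
Implicit Types w v y z : R.

Definition travel_cost w y z : \bar R :=
  if y < z then (w / (z - y))%:E else +oo%E.

(** Minus the derivative in [v] of [w / (v - y)]. The value [+oo] for [v <= y] makes the layer
    integral diverge when [z <= y] and keeps the rate nondecreasing in [y]. *)
Definition travel_rate w v y : \bar R :=
  if y < v then (w / (v - y) ^+ 2)%:E else +oo%E.

Lemma travel_cost_ge0 w y z : 0 < w -> (0 <= travel_cost w y z)%E.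
Proof.
move=> w0; rewrite /travel_cost; case: ifPn => // yz.
by rewrite lee_fin divr_ge0 ?subr_ge0 ?ltW.
Qed.

Lemma travel_rate_ge0 w v y : 0 < w -> (0 <= travel_rate w v y)%E.
Proof.
move=> w0; rewrite /travel_rate; case: ifPn => // yv.
by rewrite lee_fin divr_ge0 ?sqr_ge0 ?ltW.
Qed.

(** The real power of exponent -1 agrees with the inverse at nonnegative reals, the only values for
    which it replaces the inverse below. *)
Lemma measurable_inv_pos d (T : measurableType d) (f : T -> R) :
  measurable_fun setT f -> measurable_fun setT (fun x => (f x) `^ (-1)).
Proof. exact: measurableT_comp (measurable_powR _). Qed.

Lemma measurable_travel_cost d (T : measurableType d) w (f g : T -> R) :
  measurable_fun setT f -> measurable_fun setT g ->
  measurable_fun setT (fun x => travel_cost w (f x) (g x)).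
Proof.
move=> mf mg.
rewrite [X in measurable_fun _ X](_ : _ = fun x =>
   if f x < g x then (w * (g x - f x) `^ (-1))%:E else +oo%E).
  apply: measurable_fun_ifT => //; first exact: measurable_fun_ltr.
  apply/measurable_EFinP; apply: measurable_funM => //.
  by apply: measurable_inv_pos; exact: measurable_funB.
apply/funext => x; rewrite /travel_cost; case: ifPn => // fg.
by rewrite powR_inv1// subr_ge0 ltW.
Qed.

Lemma measurable_travel_rate d (T : measurableType d) w (f g : T -> R) :
  measurable_fun setT f -> measurable_fun setT g ->
  measurable_fun setT (fun x => travel_rate w (g x) (f x)).
Proof.
move=> mf mg.
rewrite [X in measurable_fun _ X](_ : _ = fun x =>
   if f x < g x then (w * ((g x - f x) `^ (-1)) ^+ 2)%:E else +oo%E).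
  apply: measurable_fun_ifT => //; first exact: measurable_fun_ltr.
  apply/measurable_EFinP; apply: measurable_funM => //.
  apply: measurable_funX.
  by apply: measurable_inv_pos; exact: measurable_funB.
apply/funext => x; rewrite /travel_rate; case: ifPn => // fg.
by rewrite powR_inv1 ?exprVn// subr_ge0 ltW.
Qed.

(** Fundamental theorem of calculus with the primitive [- (w / (v - y))], which tends to 0 at
    infinity. *)
Lemma integral_travel_rate_lt w y z : 0 < w -> y < z ->
  (\int[lebesgue_measure]_(v in `[z, +oo[) travel_rate w v y)%E =
  (w / (z - y))%:E.
Proof.
move=> w0 yz.
transitivity (\int[lebesgue_measure]_(v in `[z, +oo[)
    (w / (v - y) ^+ 2)%:E)%E.
  apply: eq_integral => v; rewrite inE/= in_itv/= andbT => zv.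
  by rewrite /travel_rate (lt_le_trans yz zv).
have der v : z <= v -> 
    is_derive v 1 (fun v => - (w * (v - y)^-1)) (w / (v - y) ^+ 2).
  move=> zv.
  have vy : v - y != 0 by rewrite subr_eq0 gt_eqF// (lt_le_trans yz).
  have H : is_derive v 1 (fun v => (v - y)^-1) (- (v - y) ^- 2 *: (1 - 0)).
    by apply: is_deriveV.
  rewrite (_ : w / _ = - (w *: (- (v - y) ^- 2 *: (1 - 0)))); last first.
    by rewrite /GRing.scale/= subr0 mulr1 mulrN opprK.
  exact: (is_deriveN (is_deriveZ _ _)).
rewrite (@ge0_continuous_FTC2y _ _ (fun v => - (w * (v - y)^-1)) z 0).
- by rewrite EFinN oppeK add0e.
- by move=> v zv; rewrite divr_ge0 ?sqr_ge0 ?ltW.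
- have ctn v : z <= v -> {for v, continuous (fun v => w / (v - y) ^+ 2)}.
    move=> zv; apply: continuousM; first exact: cst_continuous.
    apply: continuousV.
      by rewrite expf_neq0// subr_eq0 gt_eqF// (lt_le_trans yz).
    apply: (@continuous_comp _ _ _ (fun v => v - y) (fun x => x ^+ 2)).
      by apply: continuousB => //; exact: cst_continuous.
    exact: exprn_continuous.
  apply/continuous_within_itvcyP; split => [v|].
    by rewrite in_itv/= andbT => zv; exact/ctn/ltW.
  by apply: cvg_at_right_filter; exact: ctn.
- rewrite -oppr0 -(mulr0 w); apply: cvgN; apply: cvgMr.
  apply/gtr0_cvgV0.
    by near=> v; rewrite subr_gt0; near: v;
      apply: nbhs_pinfty_gt; exact: num_real.
  exact: cvg_addrr.
- by move=> v zv; have [] := der v (ltW zv).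
- apply: cvg_at_right_filter.
  have /derivable1_diffP/differentiable_continuous :=
    @ex_derive _ _ _ _ _ _ _ (der z (lexx z)).
  by [].
- move=> v; rewrite in_itv/= andbT => zv.
  by rewrite derive1E; have /@derive_val := der v (ltW zv).
Unshelve. all: by end_near. Qed.

Lemma travel_cost_layer w y z : 0 < w ->
  travel_cost w y z =
  (\int[lebesgue_measure]_(v in `[z, +oo[) travel_rate w v y)%E.
Proof.
move=> w0; rewrite /travel_cost; case: ltP => [yz|zy].
  by rewrite integral_travel_rate_lt.
apply/esym/eq_infty => t.
(* With this [e] the integral from [y + e] on equals [w / e], which is [|t| + 1] and so at least
   [t]. *)
pose e := w / (`|t| + 1).
have t1 : 0 < `|t| + 1 by rewrite ltr_wpDl.
have e0 : 0 < e by rewrite divr_gt0.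
apply: (@le_trans _ _ (w / (y + e - y))%:E).
  rewrite lee_fin addrAC subrr add0r /e invf_div mulrCA divff ?gt_eqF// mulr1.
  by rewrite (le_trans (ler_norm t))// lerDl.
rewrite -integral_travel_rate_lt ?ltrDl//.
apply: ge0_subset_integral => //.
- by apply: measurable_funTS; apply: measurable_travel_rate.
- by move=> v _; exact: travel_rate_ge0.
- by apply: subset_itvr; rewrite bnd_simp (le_trans zy)// lerDl ltW.
Qed.

End travel_cost.

(** * Almost-everywhere equalities drawn from integrals *)

Lemma ge0_integral_squeeze d (T : measurableType d) (R : realType)
    (mu : {measure set T -> \bar R}) (f g : T -> \bar R) :
  measurable_fun setT f -> measurable_fun setT g ->
  (forall x, 0 <= f x)%E -> (forall x, f x <= g x)%E ->
  (\int[mu]_x f x < +oo)%E -> (\int[mu]_x g x <= \int[mu]_x f x)%E ->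
  ae_eq mu setT f g.
Proof.
move=> mf mg f0 fg foo gf.
(* The gap is set to 0 where [f] is infinite, since there [f <= g] already forces equality;
   elsewhere the difference is well defined. *)
pose h x := if (f x < +oo)%E then (g x - f x)%E else 0%E.
have mh : measurable_fun setT h.
  apply: measurable_fun_ifT => //; first by apply: measurable_fun_lte.
  exact: emeasurable_funB.
have h0 x : (0 <= h x)%E.
  by rewrite /h; case: ifPn => // fx; rewrite sube_ge0 ?fg// ge0_fin_numE ?fx.
have : (\int[mu]_x f x + \int[mu]_x h x <= \int[mu]_x f x)%E.
  rewrite -ge0_integralD//; apply: (le_trans _ gf).
  apply: ge0_le_integral => //.
  - by move=> x _; rewrite adde_ge0.
  - exact: emeasurable_funD.
  - move=> x _; rewrite /h; case: ifPn => fx; last by rewrite adde0.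
    by rewrite addeC subeK// ge0_fin_numE.
rewrite -[X in (_ <= X)%E]adde0 leeD2lE; last first.
  by rewrite ge0_fin_numE ?integral_ge0.
move=> ih0.
have /ae_eq_integral_abs : (\int[mu]_x `|h x| = 0)%E.
  apply/eqP; rewrite eq_le integral_ge0// andbT.
  by under eq_integral do rewrite gee0_abs//.
move=> /(_ measurableT mh); apply: filterS => x /(_ I) hx _.
move: hx; rewrite /h; case: ifPn => [fx|]; last first.
  rewrite -leNgt leye_eq => /eqP fx _; have := fg x.
  by rewrite fx leye_eq => /eqP ->.
by move=> gf0; rewrite -[RHS](@subeK _ _ (f x)) ?ge0_fin_numE// gf0 add0e.
Qed.

(** By Tonelli, the integral over [v] of the probability of [Y <= v < Z] is the mean length of [[Y,
    Z[]. If it is 0, the length vanishes almost surely. *)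
Lemma ae_gap_le d (T : measurableType d) (R : realType) (P : probability T R)
    (Y Z : T -> R) : measurable_fun setT Y -> measurable_fun setT Z ->
  {ae lebesgue_measure, forall v : measurableTypeR R,
    P [set x | Y x <= v < Z x] = 0%E} ->
  P [set x | Y x < Z x] = 0%E.
Proof.
move=> mY mZ h.
pose f (p : T * measurableTypeR R) : \bar R :=
  if (Y p.1 <= p.2) && (p.2 < Z p.1) then 1%E else 0%E.
have mf : measurable_fun setT f.
  apply: measurable_fun_ifT => //; apply: measurable_and.
    by apply: measurable_fun_ler => //; apply: measurableT_comp.
  by apply: measurable_fun_ltr => //; apply: measurableT_comp.
have f0 p : (0 <= f p)%E by rewrite /f; case: ifP.
have mYZ (v : R) : measurable [set x | Y x <= v < Z x].
  rewrite -[X in measurable X]setTI; apply: measurable_and => //.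
    exact: measurable_fun_ler.
  exact: measurable_fun_ltr.
have mYZ' : measurable [set x | Y x < Z x].
  by rewrite -[X in measurable X]setTI; exact: measurable_fun_ltr.
have := @fubini_tonelli _ _ T (measurableTypeR R) R P lebesgue_measure f mf f0.
have -> : (\int[lebesgue_measure]_v \int[P]_x f (x, v) = 0)%E.
  rewrite (@ae_eq_integral _ _ _ _ _ (cst 0%E))//=.
  - by rewrite integral0.
  - exact: (@measurable_fun_fubini_tonelli_G _ _ T (measurableTypeR R) R P f
      mf f0).
  - apply: filterS h => v hv _.
    transitivity (\int[P]_x (\1_[set x | Y x <= v < Z x] x)%:E)%E.
      apply: eq_integral => x _; rewrite /f/= indicE.
      by case: ifPn => xv; [rewrite mem_set|rewrite memNset//; exact/negP].
    by rewrite integral_indic// setIT.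
move=> h2.
have /ae_eq_integral_abs :
    (\int[P]_x `|\int[lebesgue_measure]_v f (x, v)| = 0)%E.
  by rewrite -[RHS]h2; apply: eq_integral => x _;
    rewrite gee0_abs// integral_ge0.
move=> /(_ measurableT (measurable_fun_fubini_tonelli_F f mf f0)).
move=> [N [mN N0 hN]].
apply/eqP; rewrite eq_le measure_ge0 andbT -[leRHS]N0 le_measure ?inE//.
apply: subset_trans hN => x/= YZ /(_ I).
have -> : (\int[lebesgue_measure]_v f (x, v))%E = (Z x - Y x)%:E.
  transitivity (\int[lebesgue_measure]_v (\1_(`[Y x, Z x[%classic) v)%:E)%E.
    apply: eq_integral => v _; rewrite /f/= indicE.
    by case: ifPn => xv; [rewrite mem_set|
      rewrite memNset//= in_itv/=; exact/negP].
  by rewrite integral_indic//= setIT lebesgue_measure_itv/= lte_fin YZ.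
by move=> [/eqP]; rewrite subr_eq0 gt_eqF.
Qed.

Lemma probability_setD d (T : measurableType d) (R : realType)
    (P : probability T R) (A B : set T) : measurable A -> measurable B ->
  P (A `\` B) = (P A - P (A `&` B))%E.
Proof.
by move=> mA mB; rewrite measureD// (le_lt_trans (probability_le1 _ _)) ?ltry.
Qed.

(** * Monotone rearrangement for the cost of one edge *)

Section monotone_rearrangement.
Context d {T : measurableType d} {R : realType} (P : probability T R) (w : R).
Variables (Y Z : T -> R) (F : R -> R).
Hypothesis w0 : 0 < w.
Hypotheses (mY : measurable_fun setT Y) (mZ : measurable_fun setT Z).
Hypotheses (F_nd : nondecreasing_fun F).
Hypothesis lawZ :
  forall A : set R, measurable A -> P (Z @^-1` A) = P ((F \o Y) @^-1` A).

(** The layer of the edge cost at level [v]: integrating it over [v] gives back [travel_cost]. *)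
Let clip (v y z : R) : \bar R := if z <= v then travel_rate w v y else 0%E.

Let clip_ge0 v y z : (0 <= clip v y z)%E.
Proof. by rewrite /clip; case: ifP => // _; exact: travel_rate_ge0. Qed.

Let mFY : measurable_fun setT (F \o Y).
Proof. by apply: measurableT_comp => //; exact: nondecreasing_measurable. Qed.

Let measurable_clip (U : T -> R) : measurable_fun setT U ->
  measurable_fun setT
    (fun p : T * measurableTypeR R => clip p.2 (Y p.1) (U p.1)).
Proof.
move=> mU; apply: measurable_fun_ifT => //.
  by apply: measurable_fun_ler => //; apply: measurableT_comp.
by apply: measurable_travel_rate => //; apply: measurableT_comp.
Qed.

Let measurable_clip2 v (U : T -> R) : measurable_fun setT U ->
  measurable_fun setT (fun x => clip v (Y x) (U x)).
Proof.
move=> mU; apply: measurable_fun_ifT => //; first exact: measurable_fun_ler.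
by apply: measurable_travel_rate.
Qed.

Let integral_cost (U : T -> R) : measurable_fun setT U ->
  (\int[P]_x travel_cost w (Y x) (U x) =
   \int[lebesgue_measure]_v \int[P]_x clip v (Y x) (U x))%E.
Proof.
move=> mU.
rewrite -(@fubini_tonelli _ _ T (measurableTypeR R) R P lebesgue_measure
   (fun p => clip p.2 (Y p.1) (U p.1)) (measurable_clip mU))//.
apply: eq_integral => x _; rewrite travel_cost_layer// integral_mkcond.
apply: eq_integral => v _; rewrite patchE /clip/=.
by congr (if _ then _ else _); apply/idP/idP; rewrite inE/= in_itv/= andbT.
Qed.

Lemma travel_rate_homo v (y y' : R) : y <= y' ->
  (travel_rate w v y <= travel_rate w v y')%E.
Proof.
move=> yy'; rewrite /travel_rate; case: (ltP y' v) => [y'v|]; last first.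
  by move=> _; rewrite leey.
rewrite (le_lt_trans yy' y'v) lee_fin ler_pM2l//.
rewrite lef_pV2 ?posrE ?exprn_gt0 ?subr_gt0//.
  rewrite ler_pXn2r ?nnegrE ?subr_ge0 ?lerD2l ?lerN2// ltW//.
  by rewrite (le_lt_trans yy').
exact: le_lt_trans yy' y'v.
Qed.

(** A finite threshold is met by at most one [y], hence on a null event when [Y] has no atoms. *)
Lemma travel_rate_inj v (y y' : R) (c : R) :
  travel_rate w v y = c%:E -> travel_rate w v y' = c%:E -> y = y'.
Proof.
rewrite /travel_rate; case: ifPn => // yv [yc]; case: ifPn => // y'v [].
rewrite -yc => /(mulfI (lt0r_neq0 w0))/invr_inj/eqP.
rewrite eqrXn2 ?subr_ge0 ?ltW// => /eqP/addrI/oppr_inj/esym //.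
Qed.

Hypothesis ltYZ : P [set x | Z x <= Y x] = 0%E.

Let measurable_level (U : T -> R) v : measurable_fun setT U ->
  measurable [set x | U x <= v].
Proof.
by move=> mU; rewrite -[X in measurable X]setTI; exact: measurable_fun_ler.
Qed.

Let measurable_between (U V : T -> R) v :
  measurable_fun setT U -> measurable_fun setT V ->
  measurable [set x | U x <= v < V x].
Proof.
move=> mU mV; rewrite -[X in measurable X]setTI; apply: measurable_and => //.
  exact: measurable_fun_ler.
exact: measurable_fun_ltr.
Qed.

Let level_law v : P [set x | F (Y x) <= v] = P [set x | Z x <= v].
Proof.
have := lawZ (measurable_itv `]-oo, v]).
rewrite (_ : Z @^-1` _ = [set x | Z x <= v]); last first.
  by apply/seteqP; split => x; rewrite /= in_itv.
by move=> ->; congr (P _); apply/seteqP; split => x; rewrite /= in_itv.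
Qed.

(** The events [Z <= v] and [F Y <= v] have the same probability, so their two differences do as
    well. *)
Let between_null v : P [set x | Z x <= v < F (Y x)] = 0%E ->
  P [set x | F (Y x) <= v < Z x] = 0%E.
Proof.
have betweenE (U V : T -> R) :
    [set x | U x <= v < V x] = [set x | U x <= v] `\` [set x | V x <= v].
  by apply/seteqP; split => x/= => [/andP[? +]|[-> /negP]];
    rewrite ltNge// => /negP.
rewrite !betweenE !probability_setD; [|exact: measurable_level..].
by rewrite setIC level_law.
Qed.

(** Bathtub principle: [F Y <= v] is a lower set in [Y] with the probability of [Z <= v], so it
    collects the smallest rates. Equality leaves only points whose rate is exactly the threshold. *)
Let bathtub v :
  (\int[P]_x clip v (Y x) (F (Y x)) <= \int[P]_x clip v (Y x) (Z x))%E /\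
  ((forall y, P [set x | Y x = y] = 0%E) ->
   (\int[P]_x clip v (Y x) (F (Y x)) = \int[P]_x clip v (Y x) (Z x))%E ->
  P [set x | Z x <= v < F (Y x)] = 0%E).
Proof.
have mB1 : measurable [set x | Z x <= v] by exact: measurable_level.
have mB2 : measurable [set x | F (Y x) <= v] by exact: measurable_level.
have PE := level_law v.
have mC : measurable [set x | Z x <= v < F (Y x)].
  exact: measurable_between.
have mC' : measurable [set x | F (Y x) <= v < Z x].
  exact: measurable_between.
(* c separates the rates on {F y <= v} from those on {v < F y}; 0 is thrown in
   as the former set may be empty *)
pose S : set (\bar R) :=
  [set e | e = 0%E \/ exists2 y, F y <= v & e = travel_rate w v y].
pose c := ereal_sup S.
have c0 : (0 <= c)%E by apply: ereal_sup_ubound; left.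
have rate_le y : F y <= v -> (travel_rate w v y <= c)%E.
  by move=> Fy; apply: ereal_sup_ubound; right; exists y.
have rate_ge y : v < F y -> (c <= travel_rate w v y)%E.
  move=> Fy; apply: ub_ereal_sup => _ [->|[y' Fy' ->]].
    exact: travel_rate_ge0.
  apply: travel_rate_homo; rewrite leNgt; apply/negP => /ltW/F_nd.
  by rewrite leNgt (le_lt_trans Fy' Fy).
(* With an infinite threshold, [v < F (Y x)] forces [v <= Y x]; together with [Z x <= v] this lies
   in the event excluded by [ltYZ]. *)
have [coo|] := eqVneq c +oo%E.
  have P1 : P [set x | Z x <= v < F (Y x)] = 0%E.
    apply/eqP; rewrite eq_le measure_ge0 andbT -ltYZ le_measure ?inE//.
      rewrite -[X in measurable X]setTI; exact: measurable_fun_ler.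
    move=> x/= /andP[Zv /rate_ge]; rewrite coo leye_eq /travel_rate.
    by case: ltP => // vY _; exact: le_trans Zv vY.
  have P2 := between_null P1.
  split => //.
  rewrite (@ge0_ae_eq_integral _ _ _ _ setT _ (fun x => clip v (Y x) (Z x)))//.
  - exact: measurable_clip2.
  - exact: measurable_clip2.
  - exists ([set x | Z x <= v < F (Y x)] `|` [set x | F (Y x) <= v < Z x]).
    split.
    + exact: measurableU.
    + by rewrite measureU0.
    + move=> x/=; apply: contra_notP => /not_orP[/negP h1 /negP h2] _.
      move: h1 h2; rewrite /clip.
      by case: (leP (Z x) v); case: (leP (F (Y x)) v) => //.
move=> cNoo; have cfin : c \is a fin_num.
  by rewrite ge0_fin_numE// lt_neqAle cNoo leey.
pose D x := if Z x <= v < F (Y x) then (travel_rate w v (Y x) - c)%E else 0%E.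
have mr : measurable_fun setT (fun x => travel_rate w v (Y x)).
  exact: measurable_travel_rate.
have D0 x : (0 <= D x)%E.
  rewrite /D; case: ifP => // /andP[_ /rate_ge h].
  by rewrite sube_ge0// cfin.
have mD : measurable_fun setT D.
  apply: measurable_fun_ifT => //; last exact: emeasurable_funB.
  apply: measurable_and; first exact: measurable_fun_ler.
  exact: measurable_fun_ltr.
have mind (B : set T) : measurable B ->
    measurable_fun setT (fun x => c * (\1_B x)%:E)%E.
  by move=> mB; apply: emeasurable_funM => //; apply/measurable_EFinP.
have cind (B : set T) x : (0 <= c * (\1_B x)%:E)%E.
  by rewrite mule_ge0// lee_fin.
have iind (B : set T) : measurable B ->
    (\int[P]_x (c * (\1_B x)%:E) = c * P B)%E.
  move=> mB; rewrite ge0_integralZl//; last by apply/measurable_EFinP.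
  by rewrite integral_indic// setIT.
(* Adding [c] times the indicator of [Z <= v] on the left and of [F Y <= v] on the right changes
   both sides by the same finite amount and makes the inequality pointwise. *)
have key : (\int[P]_x clip v (Y x) (F (Y x)) + \int[P]_x D x <=
            \int[P]_x clip v (Y x) (Z x))%E.
  have cP : (c * P [set x | (Z x <= v)%R])%E \is a fin_num.
    by rewrite fin_numM// fin_num_measure.
  rewrite -(@leeD2rE _ (c * P [set x | (Z x <= v)%R])%E)//.
  rewrite -[in leRHS]PE -!iind// -!ge0_integralD//=.
  - apply: ge0_le_integral => //.
    + by move=> x _; rewrite !adde_ge0.
    + by apply: emeasurable_funD; [apply: emeasurable_funD|] => //;
        [exact: measurable_clip2|exact: mind].
    + by apply: emeasurable_funD; [exact: measurable_clip2|exact: mind].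
    move=> x _; rewrite /D /clip !indicE.
    have -> : (x \in [set x | Z x <= v]) = (Z x <= v).
      by apply/idP/idP; rewrite inE.
    have -> : (x \in [set x | F (Y x) <= v]) = (F (Y x) <= v).
      by apply/idP/idP; rewrite inE.
    case: (leP (Z x) v); case: (leP (F (Y x)) v) => h1 h2/=;
      rewrite ?mule1 ?mule0 ?adde0 ?add0e//.
    + by rewrite subeK.
    + exact: rate_le.
  - exact: measurable_clip2.
  - exact: mind.
  - by move=> x _; rewrite adde_ge0.
  - by apply: emeasurable_funD => //; exact: measurable_clip2.
  - exact: mind.
  - exact: measurable_clip2.
split; first by rewrite (le_trans _ key)// leeDl// integral_ge0.
move=> atomless clipE.
have Fle : (\int[P]_x clip v (Y x) (F (Y x)) <= c)%E.
  rewrite -[leRHS]mule1 -(@probability_setT _ _ _ P) -integral_cst//.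
  apply: ge0_le_integral => //; first exact: measurable_clip2.
  by move=> x _; rewrite /clip; case: ifPn => // /rate_le.
have ffin : (\int[P]_x clip v (Y x) (F (Y x)))%E \is a fin_num.
  by rewrite ge0_fin_numE ?integral_ge0// (le_lt_trans Fle)// -ge0_fin_numE.
move: key; rewrite -clipE -[leRHS]adde0 leeD2lE// => D_le0.
have /ae_eq_integral_abs : (\int[P]_x `|D x| = 0)%E.
  apply/eqP; rewrite eq_le integral_ge0// andbT.
  by under eq_integral do rewrite gee0_abs//.
move=> /(_ measurableT mD) [N [mN N0 hN]].
have mY1 y : measurable [set x | Y x = y].
  by rewrite -[X in measurable X]setTI;
    exact: (mY measurableT (measurable_set1 y)).
(* Outside [N] the excess [D] vanishes, so on this event the rate equals [c]. *)
have sub y0 : (forall y, travel_rate w v y = c -> y = y0) ->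
    [set x | Z x <= v < F (Y x)] `<=` N `|` [set x | Y x = y0].
  move=> hy x/= xv; have [YE|/eqP YE] := eqVneq (Y x) y0; [by right|left].
  apply: hN => /= /(_ I); rewrite /D xv => Yc; apply/YE/hy.
  by rewrite -[LHS](@subeK _ _ c)// Yc add0e.
(* If no rate equals [c] the condition is void and 0 serves. *)
have [y0 hy0] : exists y0, forall y, travel_rate w v y = c -> y = y0.
  have [[y0 hy0]|hy] := pselect (exists y0, travel_rate w v y0 = c).
    by exists y0 => y hy; apply: (@travel_rate_inj v _ _ (fine c));
      rewrite fineK.
  by exists 0 => y hyc; case: hy; exists y.
apply/eqP; rewrite eq_le measure_ge0 andbT.
rewrite (@le_trans _ _ (P (N `|` [set x | Y x = y0])))//.
  by rewrite le_measure ?inE//; [exact: measurableU|exact: sub].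
by rewrite measureU0//= N0.
Qed.

Theorem monotone_rearrangement_le :
  (\int[P]_x travel_cost w (Y x) (F (Y x)) <=
   \int[P]_x travel_cost w (Y x) (Z x))%E.
Proof.
rewrite !integral_cost//; apply: ge0_le_integral => //.
- by move=> v _; exact: integral_ge0.
- exact: (@measurable_fun_fubini_tonelli_G _ _ T (measurableTypeR R) R P
    (fun p => clip p.2 (Y p.1) (F (Y p.1))) (measurable_clip mFY)).
- exact: (@measurable_fun_fubini_tonelli_G _ _ T (measurableTypeR R) R P
    (fun p => clip p.2 (Y p.1) (Z p.1)) (measurable_clip mZ)).
- by move=> v _; have [] := bathtub v.
Qed.

(** Equal finite costs force equality in almost every layer, so both gap events are null for almost
    every [v]; [ae_gap_le] then removes the level [v]. *)
Theorem monotone_rearrangement_eq :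
  (forall y, P [set x | Y x = y] = 0%E) ->
  (\int[P]_x travel_cost w (Y x) (Z x) < +oo)%E ->
  (\int[P]_x travel_cost w (Y x) (Z x) <=
   \int[P]_x travel_cost w (Y x) (F (Y x)))%E ->
  P [set x | Z x != F (Y x)] = 0%E.
Proof.
move=> atomless costoo costle.
have FYoo := le_lt_trans monotone_rearrangement_le costoo.
move: costoo costle FYoo; rewrite !integral_cost// => costoo costle FYoo.
have : ae_eq lebesgue_measure (setT : set (measurableTypeR R))
   (fun v => \int[P]_x clip v (Y x) (F (Y x)))%E
   (fun v => \int[P]_x clip v (Y x) (Z x))%E.
  apply: ge0_integral_squeeze => //.
  - exact: (@measurable_fun_fubini_tonelli_G _ _ T (measurableTypeR R) R P
      (fun p => clip p.2 (Y p.1) (F (Y p.1))) (measurable_clip mFY)).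
  - exact: (@measurable_fun_fubini_tonelli_G _ _ T (measurableTypeR R) R P
      (fun p => clip p.2 (Y p.1) (Z p.1)) (measurable_clip mZ)).
  - by move=> v; exact: integral_ge0.
  - by move=> v; have [] := bathtub v.
move=> aeq.
have h1 : P [set x | Z x < F (Y x)] = 0%E.
  apply: ae_gap_le => //; apply: (filterS _ aeq) => v /(_ I) hv.
  by have [_ /(_ atomless hv)] := bathtub v.
have h2 : P [set x | F (Y x) < Z x] = 0%E.
  apply: ae_gap_le => //; apply: filterS aeq => v /(_ I) hv.
  by apply: between_null; have [_ /(_ atomless hv)] := bathtub v.
have mltT (U V : T -> R) : measurable_fun setT U -> measurable_fun setT V ->
    measurable [set x | U x < V x].
  by move=> mU mV; rewrite -[X in measurable X]setTI; exact: measurable_fun_ltr.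
rewrite (_ : [set x | _] = [set x | Z x < F (Y x)] `|` [set x | F (Y x) < Z x]).
  by rewrite measureU0//; exact: mltT.
by apply/seteqP; split => x/=; rewrite neq_lt => /orP.
Qed.
End monotone_rearrangement.

(** Half-open intervals form a generating class stable under intersection, and the intervals []-n,
    n]] exhaust the line. *)
Lemma ocitv_measure_unique (R : realType)
    (m1 m2 : {measure set (measurableTypeR R) -> \bar R}) :
  (forall a b : R, a <= b -> m1 `]a, b]%classic = m2 `]a, b]%classic) ->
  (forall a b : R, (m1 `]a, b]%classic < +oo)%E) ->
  forall A, measurable A -> m1 A = m2 A.
Proof.
move=> m12 m1oo.
apply: (@measure_unique _ R (measurableTypeR R) (@ocitv R)
  (fun n => `](- n%:R)%R, n%:R]%classic)) => //.
- exact: ocitvI.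
- by move=> n; exact: is_ocitv.
- apply/seteqP; split => // x _.
  exists (Num.truncn `|x|).+1 => //=; rewrite in_itv/=.
  have h := truncnS_gt `|x|.
  rewrite ltrNl (le_lt_trans _ h) ?(le_trans _ (ltW h)) ?ler_norm//.
  by rewrite -normrN ler_norm.
- move=> _ [[a b] _ <-]/=; have [ab|ba] := leP a b; first exact: m12.
  by rewrite set_itv_ge ?measure0// bnd_simp -leNgt ltW.
Qed.

(** * Laws, distribution functions and quantile functions on the line *)

Section law.
Context d d' (T : measurableType d) (T' : measurableType d') (R : realType).
Variables (P : probability T R) (f : T -> T').
Hypothesis mf : measurable_fun [set: T] f.

Definition law : probability T' R :=
  distribution P (HB.pack_for {mfun T >-> T'} f
    (isMeasurableFun.Build _ _ _ _ f mf)).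

Lemma lawE A : law A = P (f @^-1` A). Proof. by []. Qed.

Lemma ge0_integral_law (g : T' -> \bar R) :
  measurable_fun setT g -> (forall y, 0 <= g y)%E ->
  (\int[law]_y g y = \int[P]_x g (f x))%E.
Proof. exact: ge0_integral_distribution. Qed.

End law.

Section as_probability.
Context d (T : measurableType d) (R : realType).
Variables (m : {measure set T -> \bar R}) (m1 : m setT = 1%E).

Definition as_probability of m setT = 1%E : set T -> \bar R := m.

HB.instance Definition _ := isMeasure.Build _ _ _ (as_probability m1)
  (measure0 m) (measure_ge0 m) (@measure_semi_sigma_additive _ _ _ m).

HB.instance Definition _ :=
  Measure_isProbability.Build _ _ _ (as_probability m1) m1.

End as_probability.

Section unit_interval_law.
Variable R : realType.

Lemma unit_interval_mass :
  mrestr (@lebesgue_measure R) (measurable_itv `]0%R, 1%R]) setT = 1%E.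
Proof.
by rewrite /mrestr setTI lebesgue_measure_itv/= lte_fin ltr01 oppr0 adde0.
Qed.

(** The uniform law on []0, 1]]. The endpoint 0 is left out because the equivalence [quantile_le]
    fails for [s = 0] and [t < 0]. *)
Definition unit_law : probability (measurableTypeR R) R :=
  as_probability unit_interval_mass.

Lemma unit_lawE A : unit_law A = lebesgue_measure (A `&` `]0%R, 1%R]).
Proof. by []. Qed.

End unit_interval_law.

Section distribution_function.
Context (R : realType).
Implicit Types mu : probability (measurableTypeR R) R.

Definition dfun mu (t : R) : R := fine (mu `]-oo, t]%classic).

Lemma dfunE mu t : mu `]-oo, t]%classic = (dfun mu t)%:E.
Proof. by rewrite /dfun fineK// fin_num_measure. Qed.

Lemma dfun_nd mu : nondecreasing_fun (dfun mu).
Proof.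
move=> s t st; rewrite -lee_fin -!dfunE le_measure ?inE//.
by apply: subset_itvl; rewrite bnd_simp.
Qed.

Lemma dfun_ge0 mu t : 0 <= dfun mu t.
Proof. by rewrite -lee_fin -dfunE. Qed.

Lemma dfun_le1 mu t : dfun mu t <= 1.
Proof. by rewrite -lee_fin -dfunE probability_le1. Qed.

Lemma dfun_right_continuous mu (a : R) : dfun mu x @[x --> a^'+] --> dfun mu a.
Proof.
have mid : measurable_fun [set: measurableTypeR R] 
    (idfun : measurableTypeR R -> R).
  exact: measurable_id.
pose X : {RV mu >-> R} := HB.pack_for {mfun measurableTypeR R >-> R}
  (idfun : measurableTypeR R -> R)
  (isMeasurableFun.Build _ _ _ _ _ mid).
apply: fine_cvg; rewrite fineK ?fin_num_measure//.
exact: (@cdf_right_continuous _ _ _ _ X a).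
Qed.

Lemma dfun_itv mu (a b : R) : a <= b ->
  mu `]a, b]%classic = (dfun mu b - dfun mu a)%:E.
Proof.
move=> ab; have -> : `]a, b]%classic = `]-oo, b] `\` `]-oo, a].
  apply/seteqP; split => x/=; rewrite !in_itv/= ltNge.
    by move=> /andP[/negP ? ?].
  by move=> [-> /negP ->].
rewrite measureD//; last first.
  by rewrite (le_lt_trans (probability_le1 _ _)) ?ltry.
rewrite setIidr; last by apply: subset_itvl; rewrite bnd_simp.
by rewrite EFinB -!dfunE.
Qed.

Lemma dfun_inj mu nu : dfun mu =1 dfun nu ->
  forall A, measurable A -> mu A = nu A.
Proof.
move=> munu; apply: ocitv_measure_unique => a b.
  by move=> ab; rewrite /= !dfun_itv// !munu.
by rewrite (le_lt_trans (probability_le1 _ _)) ?ltry.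
Qed.

End distribution_function.

Section quantile.
Context (R : realType) (tf : R) (mu : probability (measurableTypeR R) R).

(** The generalised inverse of [dfun mu]. The alternative [t = tf] keeps the set nonempty for every
    real [s], so that bounds and monotonicity hold on the whole line. *)
Definition quantile (s : R) : R :=
  inf [set t | 0 <= t <= tf /\ (t = tf \/ s <= dfun mu t)].

Hypotheses (tf0 : 0 <= tf) (mu1 : mu `[0, tf]%classic = 1%E).

Lemma dfun_max : dfun mu tf = 1.
Proof.
apply/le_anti; rewrite dfun_le1/= -lee_fin -dfunE -mu1 le_measure ?inE//.
by apply: subset_itvr; rewrite bnd_simp.
Qed.

Lemma dfun_neg t : t < 0 -> dfun mu t = 0.
Proof.
move=> t0; apply/le_anti; rewrite dfun_ge0 andbT -lee_fin -dfunE.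
have : mu (~` `[0, tf]%classic) = 0%E by rewrite probability_setC// mu1 subee.
move=> mu0; rewrite -[leRHS]mu0 le_measure ?inE//; first exact: measurableC.
move=> x/=; rewrite !in_itv/= => xt /andP[x0 _].
by move: (le_lt_trans (le_trans x0 xt) t0); rewrite ltxx.
Qed.

Let S s := [set t | 0 <= t <= tf /\ (t = tf \/ s <= dfun mu t)].
Let S_tf s : S s tf. Proof. by split; [rewrite tf0 lexx|left]. Qed.
Let S_lb s : lbound (S s) 0. Proof. by move=> t [/andP[]]. Qed.
Let S_has_inf s : has_inf (S s).
Proof. by split; [exists tf|exists 0]. Qed.

Lemma quantile_itv s : 0 <= quantile s <= tf.
Proof.
apply/andP; split.
  by apply: lb_le_inf; [exists tf; exact: S_tf|exact: S_lb].
by apply: ge_inf; [exists 0; exact: S_lb|exact: S_tf].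
Qed.

Lemma quantile_nd : nondecreasing_fun quantile.
Proof.
move=> s s' ss'; apply: lb_le_inf; first by exists tf; exact: S_tf.
move=> t [t0 ts']; apply: ge_inf; first by exists 0; exact: S_lb.
by split=> //; case: ts' => [->|/(le_trans ss')]; [left|right].
Qed.

Lemma measurable_quantile : measurable_fun [set: measurableTypeR R]
  (quantile : measurableTypeR R -> measurableTypeR R).
Proof. exact: nondecreasing_measurable quantile_nd. Qed.

(** Right continuity: if [dfun mu] were below [s] at the infimum, it would stay below [s] slightly
    to the right, where elements of the set are found. *)
Lemma dfun_quantile_ge s : s <= 1 -> s <= dfun mu (quantile s).
Proof.
move=> s1; rewrite leNgt; apply/negP => lts.
have := @dfun_right_continuous _ mu (quantile s).
move=> /cvgrPdist_lt/(_ (s - dfun mu (quantile s))).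
rewrite subr_gt0 => /(_ lts)[e/= e0 he].
have [t [t0 St] tlt] : exists2 t, S s t & t < quantile s + e / 2.
  by apply: inf_adherent => //; rewrite divr_gt0.
have lts' : dfun mu (quantile s + e / 2) < s.
  have := he (quantile s + e / 2).
  rewrite /ball/= opprD addNKr normrN gtr0_norm ?divr_gt0//.
  rewrite ltr_pdivrMr// ltr_pMr// ltr1n ltrDl.
  rewrite divr_gt0// => /(_ isT isT).
  by rewrite ltr_norml => /andP[+ _]; rewrite ltrNl opprB ltrD2r.
case: St => [tE|st].
  have := dfun_nd mu (ltW tlt); rewrite tE dfun_max => /(le_trans s1).
  by rewrite leNgt lts'.
have := le_trans st (dfun_nd mu (ltW tlt)).
by rewrite leNgt lts'.
Qed.

(** The Galois connection between the two functions. Positivity of [s] rules out negative [t], where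
    [dfun mu] is 0. *)
Lemma quantile_le s t : 0 < s <= 1 -> (quantile s <= t) = (s <= dfun mu t).
Proof.
move=> /andP[s0 s1]; apply/idP/idP => [qt|st].
  exact: le_trans (dfun_quantile_ge s1) (dfun_nd mu qt).
have [ttf|tft] := leP t tf; last first.
  by apply: le_trans (ltW tft); have /andP[] := quantile_itv s.
apply: ge_inf; first by exists 0; exact: S_lb.
split; last by right.
rewrite ttf andbT leNgt; apply/negP => /dfun_neg E.
by move: st; rewrite E leNgt s0.
Qed.

(** Inverse transform sampling: by [quantile_le] the levels whose quantile is at most [t] form []0,
    dfun mu t]]. *)
Lemma law_quantile A : measurable A ->
  law (unit_law R) measurable_quantile A = mu A.
Proof.
apply: dfun_inj => t; rewrite /dfun lawE unit_lawE; congr fine.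
rewrite dfunE (_ : _ `&` _ = `]0, dfun mu t]%classic).
  rewrite lebesgue_measure_itv/= lte_fin oppr0 adde0.
  case: ltP => // ft0; congr EFin.
  by apply/le_anti; rewrite ft0 dfun_ge0.
apply/seteqP; split => s/=; rewrite !in_itv/=.
  by move=> [qs s01]; rewrite -quantile_le// qs andbT; have /andP[] := s01.
move=> /andP[s0 st]; have s1 := le_trans st (dfun_le1 mu t).
by split; [rewrite quantile_le ?s0|rewrite s0].
Qed.

End quantile.

(** * Crossing laws of density at most [r], seen through their quantile functions *)

Section spread.
Context (R : realType) (tf r : R).
Hypotheses (tf0 : 0 < tf) (r0 : 0 < r).

(* quantile functions of the laws on [0, tf] with density at most r *)
Definition spread (q : R -> R) := [/\ nondecreasing_fun q,
  forall s, 0 <= q s <= tf &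
  forall s s', 0 < s -> s <= s' -> s' <= 1 -> q s + (s' - s) / r <= q s'].

(** An interval of length [(s' - s) / r] ending at the quantile of [s'] has mass at most [s' - s],
    so the distribution function is still at least [s] at its left end. *)
Lemma spread_quantile (sigma : probability (measurableTypeR R) R) :
  sigma `[0, tf]%classic = 1%E ->
  (forall A, measurable A -> (sigma A <= r%:E * lebesgue_measure A)%E) ->
  spread (quantile tf sigma).
Proof.
move=> sigma1 sigma_le; split.
- by apply: quantile_nd; exact: ltW.
- by move=> s; apply: quantile_itv => //; exact: ltW.
- move=> s s' s0 ss' s1.
  rewrite -lerBrDr quantile_le//; [|exact: ltW|by rewrite s0 (le_trans ss')].
  set t := quantile tf sigma s'.
  have h : s' <= dfun sigma t by apply: dfun_quantile_ge => //; exact: ltW.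
  have d0 : 0 <= (s' - s) / r by rewrite divr_ge0 ?subr_ge0// ltW.
  have tt : t - (s' - s) / r <= t by rewrite lerBlDr lerDl.
  have := sigma_le `]t - (s' - s) / r, t]%classic (measurable_itv _).
  rewrite dfun_itv// lebesgue_measure_itv/= lte_fin.
  case: ltP => [_|tle].
    rewrite -EFinD -EFinM lee_fin subKr mulrCA divff ?gt_eqF// mulr1.
    by move: h; lra.
  by rewrite mule0 lee_fin; move: h; lra.
Qed.

Variable q : R -> R.
Hypothesis qs : spread q.

Lemma measurable_spread : measurable_fun [set: measurableTypeR R]
  (q : measurableTypeR R -> measurableTypeR R).
Proof. by have [nd _ _] := qs; exact: nondecreasing_measurable. Qed.

Let sigma := law (unit_law R) measurable_spread.

Lemma law_spread_itv : sigma `[0, tf]%classic = 1%E.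
Proof.
rewrite lawE (_ : _ @^-1` _ = setT) ?probability_setT//.
by apply/seteqP; split => // s _/=; rewrite in_itv/=; have [_ ->] := qs.
Qed.

(** The spread condition makes [q] strictly increasing on []0, 1]], so the levels with value at most
    [q s] are exactly []0, s]]. *)
Lemma dfun_law_spread s : 0 < s <= 1 -> dfun sigma (q s) = s.
Proof.
move=> /andP[s0 s1]; rewrite /dfun lawE unit_lawE.
rewrite (_ : _ `&` _ = `]0, s]%classic).
  by rewrite lebesgue_measure_itv/= lte_fin s0 oppr0 adde0.
have [nd _ qsp] := qs.
apply/seteqP; split => x/=; rewrite !in_itv/=; last first.
  by move=> /andP[x0 xs]; rewrite x0 (le_trans xs s1) nd.
move=> [qx /andP[x0 x1]]; rewrite x0/= leNgt; apply/negP => sx.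
have := qsp s x s0 (ltW sx) x1; rewrite leNgt => /negP; apply.
by rewrite (le_lt_trans qx)// ltrDl divr_gt0// subr_gt0.
Qed.

(** The levels sent into []t, t']] form a set of diameter at most [r * (t' - t)], contained in an
    interval of that length starting at its infimum. *)
Lemma dfun_spread_lip t t' : t <= t' ->
  dfun sigma t' - dfun sigma t <= r * (t' - t).
Proof.
move=> tt'; rewrite -lee_fin -dfun_itv// lawE unit_lawE.
set B := (X in lebesgue_measure X).
have [B0|/set0P[x0 Bx0]] := eqVneq B set0.
  by rewrite B0 measure0 lee_fin mulr_ge0 ?subr_ge0// ltW.
have [nd _ qsp] := qs.
have L0 : 0 <= r * (t' - t) by rewrite mulr_ge0 ?subr_ge0// ltW.
have BB x y : B x -> B y -> x <= y + r * (t' - t).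
  rewrite /B/= !in_itv/= => -[/andP[_ xt'] /andP[_ x1]].
  move=> [/andP[ty _] /andP[y0 _]].
  have [xy|yx] := leP x y; first by rewrite (le_trans xy)// lerDl.
  have := qsp y x y0 (ltW yx) x1.
  rewrite -lerBrDl -ler_pdivlMr ?invr_gt0// invrK => h.
  rewrite -lerBlDl (le_trans h)// mulrC ler_pM2l// lerB//; exact: ltW.
have hinf : has_lbound B.
  by exists 0 => x [_ /=]; rewrite in_itv/= => /andP[/ltW].
have mB : measurable B.
  apply: measurableI => //; rewrite -[X in measurable X]setTI.
  exact: measurable_spread.
rewrite (@le_trans _ _
  (lebesgue_measure `[inf B, inf B + r * (t' - t)]%classic))//.
  rewrite le_measure ?inE// => x Bx; rewrite /= in_itv/=; apply/andP; split.
    exact: ge_inf.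
  rewrite -lerBlDr; apply: lb_le_inf; first by exists x0.
  by move=> y By; rewrite lerBlDr; exact: BB.
rewrite lebesgue_measure_itv/= lte_fin; case: ifP => _; last by rewrite lee_fin.
by rewrite -EFinD addrAC subrr add0r.
Qed.

(** From intervals to Borel sets: [r * t - dfun sigma t] is nondecreasing and right-continuous, so
    it defines a Stieltjes measure [nu], and [r] times Lebesgue measure is [nu] plus [sigma]. *)
Lemma law_spread_le A : measurable A ->
  (sigma A <= r%:E * lebesgue_measure A)%E.
Proof.
pose c0 t := r * t - dfun sigma t.
have c_nd : nondecreasing_fun c0.
  by move=> t t' tt'; rewrite /c0; have := dfun_spread_lip tt'; lra.
have c_rc x : c0 y @[y --> x^'+] --> c0 x.
  apply: cvgB; last exact: dfun_right_continuous.
  by apply: cvgMr; apply: cvg_at_right_filter; exact: cvg_id.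
have [c cE] : exists c : cumulative R R, forall x, c x = c0 x.
  by exists (HB.pack_for (cumulative R R) c0
    (isCumulative.Build R _ R c0 c_nd c_rc)).
pose nu := lebesgue_stieltjes_measure c.
pose rl := mscale (NngNum (ltW r0)) (@lebesgue_measure R).
have nuE a b : a <= b -> nu `]a, b]%classic = (c0 b - c0 a)%:E.
  move=> ab; rewrite /nu /lebesgue_stieltjes_measure /measure_extension/=.
  rewrite measurable_mu_extE/=; last exact: is_ocitv.
  by rewrite wlength_itv_bnd// !cE.
move=> mA.
have -> : (r%:E * lebesgue_measure A)%E = measure_add nu sigma A.
  have : forall A, measurable A -> rl A = measure_add nu sigma A.
    apply: ocitv_measure_unique => a b.
      move=> ab; rewrite -[RHS]/(measure_add nu sigma _) measure_addE.
      rewrite [X in (X + _)%E]nuE// [X in (_ + X)%E]dfun_itv//.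
      rewrite /rl /= /mscale/= lebesgue_measure_itv/= lte_fin.
      case: ltP => [_|ba].
        by rewrite -!EFinD -EFinM /c0; congr EFin; ring.
      have -> : a = b by apply/le_anti; rewrite ab.
      by rewrite mule0 !subrr add0e.
    rewrite /rl /= /mscale/= lebesgue_measure_itv/= lte_fin.
    by case: ifP => _; rewrite -?EFinD -?EFinM ?mule0 ltry.
  exact.
by rewrite measure_addE leeDr.
Qed.
End spread.

(** * The cost as a sum over the two edges, and its measurability *)

Lemma travel_cost_lt d (T : measurableType d) (R : realType)
    (P : probability T R) (w : R) (Y Z : T -> R) : 0 < w ->
  measurable_fun setT Y -> measurable_fun setT Z ->
  (\int[P]_x travel_cost w (Y x) (Z x) < +oo)%E ->
  P [set x | Z x <= Y x] = 0%E.
Proof.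
move=> w0 mY mZ costoo.
have icost : P.-integrable setT (fun x => travel_cost w (Y x) (Z x)).
  apply/integrableP; split; first exact: measurable_travel_cost.
  by under eq_integral do rewrite gee0_abs ?travel_cost_ge0//.
have [N [mN N0 hN]] := integrable_ae measurableT icost.
apply/eqP; rewrite eq_le measure_ge0 andbT -[leRHS]N0 le_measure ?inE//.
  by rewrite -[X in measurable X]setTI; exact: measurable_fun_ler.
apply: subset_trans hN => x/= ZY /(_ I).
by rewrite /travel_cost ltNge ZY.
Qed.

Section cost_facts.
Context (R : realType) (w01 w12 : R).
Hypotheses (hw01 : 0 < w01) (hw12 : 0 < w12).

Lemma measurable_t0 : measurable_fun setT (@t0_of R).
Proof. exact: (measurableT_comp measurable_fst measurable_fst). Qed.

Lemma measurable_t1 : measurable_fun setT (@t1_of R).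
Proof. exact: (measurableT_comp measurable_snd measurable_fst). Qed.

Lemma measurable_t2 : measurable_fun setT (@t2_of R).
Proof. exact: measurable_snd. Qed.

Lemma costE (x : times R) : cost w01 w12 x =
  (travel_cost w01 (t0_of x) (t1_of x) + travel_cost w12 (t1_of x) (t2_of x))%E.
Proof. by rewrite /cost /travel_cost; case: ltP => // _; case: ltP. Qed.

Lemma cost_ge0 (x : times R) : (0 <= cost w01 w12 x)%E.
Proof. by rewrite costE adde_ge0// travel_cost_ge0. Qed.

Lemma measurable_cost : measurable_fun setT (cost w01 w12).
Proof.
rewrite (_ : cost w01 w12 = fun x => (travel_cost w01 (t0_of x) (t1_of x) +
  travel_cost w12 (t1_of x) (t2_of x))%E); last first.
  by apply/funext => x; exact: costE.
apply: emeasurable_funD; apply: measurable_travel_cost.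
- exact: measurable_t0.
- exact: measurable_t1.
- exact: measurable_t1.
- exact: measurable_t2.
Qed.

Lemma measurable_pairs d (T : measurableType d)
    (f g h : T -> measurableTypeR R) :
  measurable_fun setT f -> measurable_fun setT g -> measurable_fun setT h ->
  measurable_fun setT (fun x => ((f x, g x), h x)).
Proof.
by move=> mf mg mh; apply/measurable_fun_pair => //; exact/measurable_fun_pair.
Qed.

Lemma eq_unit_law (A B : set (measurableTypeR R)) :
  (forall s, 0 < s <= 1 -> (A s <-> B s)) -> unit_law R A = unit_law R B.
Proof.
move=> AB; rewrite !unit_lawE; congr lebesgue_measure.
by apply/seteqP; split=> s/=; rewrite in_itv/= => -[Xs s01]; split => //;
  move: Xs; rewrite AB.
Qed.

Lemma ae_unit_law (A : set (measurableTypeR R)) :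
  (forall s, 0 < s <= 1 -> A s) -> {ae unit_law R, forall s, A s}.
Proof.
move=> hA; exists (~` `]0, 1]%classic); split.
- exact: measurableC.
- by rewrite unit_lawE setICl measure0.
- by apply: subsetC => s/=; rewrite in_itv/=; exact: hA.
Qed.

Lemma eq_integral_unit_law (f g : measurableTypeR R -> \bar R) :
  measurable_fun setT f -> measurable_fun setT g ->
  (forall s, 0 <= f s)%E -> (forall s, 0 <= g s)%E ->
  (forall s, 0 < s <= 1 -> f s = g s) ->
  (\int[unit_law R]_s f s = \int[unit_law R]_s g s)%E.
Proof.
move=> mf mg f0 g0 fg; apply: ge0_ae_eq_integral => //.
have [N [mN N0 fgN]] := ae_unit_law fg.
by exists N; split => //; apply: subset_trans fgN; apply: subsetC => s fgs _.
Qed.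

End cost_facts.

(** * Comonotone plans parametrised by a crossing quantile *)

Section toll_station_problem.
Context (R : realType) (tf r w01 w12 : R).
Variables (mu0 muT : probability (measurableTypeR R) R).
Hypotheses (tf0 : 0 < tf) (r0 : 0 < r) (hw01 : 0 < w01) (hw12 : 0 < w12).
Hypotheses (mu0_tf : mu0 `[0, tf]%classic = 1%E).
Hypotheses (muT_tf : muT `[0, tf]%classic = 1%E).

Let a := quantile tf mu0.
Let b := quantile tf muT.

Let a_nd : nondecreasing_fun a. Proof. exact/quantile_nd/ltW. Qed.
Let b_nd : nondecreasing_fun b. Proof. exact/quantile_nd/ltW. Qed.

(** The three times are read at the same level [s], with [q] as the quantile function of the
    crossing law. *)
Definition trip (q : R -> R) (s : measurableTypeR R) : times R :=
  ((quantile tf mu0 s, q s), quantile tf muT s).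

Definition trip_cost (q : R -> R) : \bar R :=
  (\int[unit_law R]_s cost w01 w12 (trip q s))%E.

(** The monotone rearrangement as a function of crossing time: [dfun sigma] recovers the level, and
    the quantile turns it into a departure time. *)
Definition departure (sigma : probability (measurableTypeR R) R) (t : R) : R :=
  quantile tf mu0 (dfun sigma t).

Definition arrival (sigma : probability (measurableTypeR R) R) (t : R) : R :=
  quantile tf muT (dfun sigma t).

Lemma departure_nd sigma : nondecreasing_fun (departure sigma).
Proof. by move=> s t st; apply/a_nd/dfun_nd. Qed.

Lemma arrival_nd sigma : nondecreasing_fun (arrival sigma).
Proof. by move=> s t st; apply/b_nd/dfun_nd. Qed.

Lemma measurable_through sigma :
  measurable_fun setT (through (departure sigma) (arrival sigma)).
Proof.
apply: measurable_pairs.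
- by apply: nondecreasing_measurable => //; exact: departure_nd.
- exact: measurable_id.
- by apply: nondecreasing_measurable => //; exact: arrival_nd.
Qed.

Lemma measurable_trip q : spread tf r q -> measurable_fun setT (trip q).
Proof.
move=> qs; apply: measurable_pairs.
- exact: (measurable_quantile _ (ltW tf0)).
- exact: measurable_spread qs.
- exact: (measurable_quantile _ (ltW tf0)).
Qed.

Lemma total_cost_law q (qs : spread tf r q) :
  total_cost w01 w12 (law (unit_law R) (measurable_trip qs)) = trip_cost q.
Proof.
by rewrite /total_cost ge0_integral_law//;
  [exact: measurable_cost|exact: cost_ge0].
Qed.

Lemma feasible_trip q (qs : spread tf r q) :
  feasible tf r mu0 muT (law (unit_law R) (measurable_trip qs)).
Proof.
have [_ q0 _] := qs.
split.
- rewrite -[LHS]/(unit_law R (trip q @^-1` ~` cube tf)).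
  rewrite (_ : _ @^-1` _ = set0) ?measure0//.
  apply/seteqP; split => // s/=; apply.
  by split; rewrite in_itv/= ?(quantile_itv _ (ltW tf0))//; exact: q0.
- by move=> A mA; rewrite -(law_quantile (ltW tf0) mu0_tf mA).
- by move=> A mA; rewrite -(law_quantile (ltW tf0) muT_tf mA).
- by move=> A mA; exact: (law_spread_le r0 qs mA).
Qed.

(** * Comparison of a feasible plan with the trip along its own crossing quantile *)

Section lower_bound.
Variable pi : {measure set (times R) -> \bar R}.
Hypothesis pi_feas : feasible tf r mu0 muT pi.

Lemma feasible_mass : pi setT = 1%E.
Proof.
by have [_ h _ _] := pi_feas; have := h _ measurableT; rewrite probability_setT.
Qed.

Let P : probability (times R) R := as_probability feasible_mass.

Definition crossing : probability (measurableTypeR R) R :=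
  law P (@measurable_t1 R).

Local Notation sigma := crossing.
Local Notation q := (quantile tf sigma).

Lemma crossing_itv : sigma `[0, tf]%classic = 1%E.
Proof.
have [h _ _ _] := pi_feas.
have mc : measurable (@cube R tf).
  rewrite (_ : cube tf = (@t0_of R @^-1` `[0, tf]) `&` (@t1_of R @^-1` `[0, tf])
      `&` (@t2_of R @^-1` `[0, tf])).
    by apply: measurableI; [apply: measurableI|];
      rewrite -[X in measurable X]setTI;
      [apply: measurable_t0|apply: measurable_t1|apply: measurable_t2].
  by apply/seteqP; split => x /=; [move=> []|move=> [[]]].
apply/eqP; rewrite eq_le probability_le1// andTb.
rewrite -[leLHS]sube0 -[X in (1 - X)%E]h.
have -> : pi (~` cube tf) = P (~` cube tf) by [].
rewrite -probability_setC ?setCK//; last exact: measurableC.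
rewrite /crossing lawE le_measure ?inE//; last by move=> x [].
by rewrite -[X in measurable X]setTI; exact: measurable_t1.
Qed.

Lemma crossing_le A : measurable A -> (sigma A <= r%:E * lebesgue_measure A)%E.
Proof. by have [_ _ _] := pi_feas; exact. Qed.

Lemma crossing_spread : spread tf r q.
Proof. exact: spread_quantile crossing_itv crossing_le. Qed.

Lemma dfun_crossing s : 0 < s <= 1 -> dfun sigma (q s) = s.
Proof.
move=> s01; rewrite -[RHS](dfun_law_spread r0 crossing_spread s01).
rewrite /dfun -(law_quantile (ltW tf0) crossing_itv)//.
Qed.

Lemma through_trip s : 0 < s <= 1 ->
  through (departure sigma) (arrival sigma) (q s) = trip q s.
Proof. by move=> s01; rewrite /through /departure /arrival dfun_crossing. Qed.

Lemma crossing_quantile A : measurable A -> sigma A = unit_law R (q @^-1` A).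
Proof. by move=> mA; rewrite -(law_quantile (ltW tf0) crossing_itv mA). Qed.

Lemma integral_crossing (f : measurableTypeR R -> \bar R) :
  measurable_fun setT f -> (forall t, 0 <= f t)%E ->
  (\int[sigma]_t f t = \int[unit_law R]_s f (q s))%E.
Proof.
move=> mf f0.
rewrite -(ge0_integral_law (unit_law R)
  (measurable_quantile sigma (ltW tf0)))//.
apply: eq_measure_integral => A mA _.
exact: (esym (law_quantile (ltW tf0) crossing_itv mA)).
Qed.

Lemma integral_through :
  (\int[P]_x cost w01 w12
     (through (departure sigma) (arrival sigma) (t1_of x)) = trip_cost q)%E.
Proof.
pose f t := cost w01 w12 (through (departure sigma) (arrival sigma) t).
have mc : measurable_fun setT f.
  apply: measurableT_comp; first exact: measurable_cost.
  exact: measurable_through.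
rewrite -(@ge0_integral_law _ _ _ _ _ P _ (@measurable_t1 R) f)//; last first.
  by move=> t; exact: cost_ge0.
rewrite integral_crossing//; last by move=> t; exact: cost_ge0.
apply: eq_integral_unit_law.
- apply: (measurableT_comp mc).
  exact: (measurable_quantile _ (ltW tf0)).
- apply: measurableT_comp; first exact: measurable_cost.
  exact: measurable_trip crossing_spread.
- by move=> s; exact: cost_ge0.
- by move=> s; exact: cost_ge0.
- by move=> s s01; rewrite /f through_trip.
Qed.

(** Both sides are [muT]: since [dfun sigma] undoes [q] on []0, 1]], the arrival map at [q s] is the
    quantile of [muT] at [s]. *)
Lemma law_arrival A : measurable A ->
  P (@t2_of R @^-1` A) = P ((arrival sigma \o @t1_of R) @^-1` A).
Proof.
move=> mA; have [_ _ h _] := pi_feas.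
transitivity (muT A); first by rewrite -h.
have mA' : measurable (arrival sigma @^-1` A : set (measurableTypeR R)).
  rewrite -[X in measurable X]setTI.
  by apply: (nondecreasing_measurable _ (@arrival_nd sigma)).
rewrite comp_preimage -[RHS](lawE P (@measurable_t1 R)) crossing_quantile//.
rewrite -(law_quantile (ltW tf0) muT_tf mA).
by rewrite lawE; apply: eq_unit_law => s s01;
  rewrite /arrival/= dfun_crossing.
Qed.

Lemma law_departure A : measurable A ->
  P (@t0_of R @^-1` A) = P ((departure sigma \o @t1_of R) @^-1` A).
Proof.
move=> mA; have [_ h _ _] := pi_feas.
transitivity (mu0 A); first by rewrite -h.
have mA' : measurable (departure sigma @^-1` A : set (measurableTypeR R)).
  rewrite -[X in measurable X]setTI.
  by apply: (nondecreasing_measurable _ (@departure_nd sigma)).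
rewrite comp_preimage -[RHS](lawE P (@measurable_t1 R)) crossing_quantile//.
rewrite -(law_quantile (ltW tf0) mu0_tf mA).
by rewrite lawE; apply: eq_unit_law => s s01;
  rewrite /departure/= dfun_crossing.
Qed.

Lemma crossing_atomless t : P [set x | t1_of x = t] = 0%E.
Proof.
apply/eqP; rewrite eq_le measure_ge0 andbT.
have := crossing_le (measurable_set1 t).
by rewrite lebesgue_measure_set1 mule0.
Qed.

Lemma total_costE : total_cost w01 w12 pi =
  (\int[P]_x travel_cost w01 (t0_of x) (t1_of x) +
   \int[P]_x travel_cost w12 (t1_of x) (t2_of x))%E.
Proof.
rewrite -ge0_integralD//.
- by apply: eq_integral => x _; rewrite costE.
- by move=> x _; exact: travel_cost_ge0.
- by apply: measurable_travel_cost; [exact: measurable_t0|exact: measurable_t1].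
- by move=> x _; exact: travel_cost_ge0.
- by apply: measurable_travel_cost; [exact: measurable_t1|exact: measurable_t2].
Qed.

Lemma trip_costE : trip_cost q =
  (\int[P]_x travel_cost w01 (departure sigma (t1_of x)) (t1_of x) +
   \int[P]_x travel_cost w12 (t1_of x) (arrival sigma (t1_of x)))%E.
Proof.
have mD : measurable_fun setT (fun x => departure sigma (@t1_of R x)).
  apply: (measurableT_comp
    (nondecreasing_measurable _ (@departure_nd sigma))) => //.
  exact: measurable_t1.
have mA : measurable_fun setT (fun x => arrival sigma (@t1_of R x)).
  apply: (measurableT_comp
    (nondecreasing_measurable _ (@arrival_nd sigma))) => //.
  exact: measurable_t1.
rewrite -integral_through -ge0_integralD//.
- by apply: eq_integral => x _; rewrite costE.
- by move=> x _; exact: travel_cost_ge0.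
- by apply: measurable_travel_cost => //; exact: measurable_t1.
- by move=> x _; exact: travel_cost_ge0.
- by apply: measurable_travel_cost => //; exact: measurable_t1.
Qed.

(* time reversal turns the departure part into an arrival part *)
Let travel_costN (w y z : R) : travel_cost w (- z) (- y) = travel_cost w y z.
Proof. by rewrite /travel_cost ltrN2 opprK addrC. Qed.

Let mN1 : measurable_fun setT (fun x => - @t1_of R x).
Proof. by apply: measurableT_comp => //; exact: measurable_t1. Qed.

Let mN0 : measurable_fun setT (fun x => - @t0_of R x).
Proof. by apply: measurableT_comp => //; exact: measurable_t0. Qed.

Let departureN_nd : nondecreasing_fun (fun y => - departure sigma (- y)).
Proof. by move=> y y' yy'; rewrite lerN2 departure_nd// lerN2. Qed.

Let lawN (A : set R) : measurable A ->
  P ((fun x => - @t0_of R x) @^-1` A) =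
  P (((fun y => - departure sigma (- y)) \o (fun x => - @t1_of R x)) @^-1` A).
Proof.
move=> mA.
have mA' : measurable ((-%R : R -> R) @^-1` A).
  rewrite -[X in measurable X]setTI; exact: (@oppr_measurable R setT).
transitivity (P ((departure sigma \o @t1_of R) @^-1` (-%R @^-1` A))).
  exact: (law_departure mA').
by congr (P _); apply/funext => x; rewrite /preimage/= (opprK (t1_of x)).
Qed.

Section finite_cost.
Hypothesis costoo : (total_cost w01 w12 pi < +oo)%E.

Let cost01oo : (\int[P]_x travel_cost w01 (t0_of x) (t1_of x) < +oo)%E.
Proof.
apply: le_lt_trans costoo; rewrite total_costE leeDl// integral_ge0// => x _.
exact: travel_cost_ge0.
Qed.

Let cost12oo : (\int[P]_x travel_cost w12 (t1_of x) (t2_of x) < +oo)%E.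
Proof.
apply: le_lt_trans costoo; rewrite total_costE leeDr// integral_ge0// => x _.
exact: travel_cost_ge0.
Qed.

Let lt12 : P [set x | t2_of x <= t1_of x] = 0%E.
Proof.
apply: travel_cost_lt cost12oo => //.
  exact: measurable_t1.
exact: measurable_t2.
Qed.

Let lt01 : P [set x | - t0_of x <= - t1_of x] = 0%E.
Proof.
apply: (@travel_cost_lt _ _ _ P w01) => //.
by under eq_integral do rewrite travel_costN.
Qed.

Let le12 : (\int[P]_x travel_cost w12 (t1_of x) (arrival sigma (t1_of x)) <=
            \int[P]_x travel_cost w12 (t1_of x) (t2_of x))%E.
Proof.
apply: monotone_rearrangement_le => //.
- exact: measurable_t1.
- exact: measurable_t2.
- exact: arrival_nd.
- exact: law_arrival.
Qed.

Let le01 : (\int[P]_x travel_cost w01 (departure sigma (t1_of x)) (t1_of x) <=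
            \int[P]_x travel_cost w01 (t0_of x) (t1_of x))%E.
Proof.
have := @monotone_rearrangement_le _ _ _ P w01 (fun x => - t1_of x)
  (fun x => - t0_of x) (fun y => - departure sigma (- y)) hw01 mN1 mN0
  departureN_nd lawN lt01.
under eq_integral => x _ do rewrite (opprK (t1_of x)) travel_costN.
by under [in leRHS]eq_integral do rewrite travel_costN.
Qed.

Lemma trip_cost_le_finite : (trip_cost q <= total_cost w01 w12 pi)%E.
Proof. by rewrite trip_costE total_costE leeD. Qed.

(** Finiteness lets the inequality of sums split into equality on each edge. The equality case of
    the rearrangement then puts the plan on the graph of the two maps, up to a null set. *)
Lemma feasible_through : (total_cost w01 w12 pi <= trip_cost q)%E ->
  forall A, measurable A ->
  pi A = sigma (through (departure sigma) (arrival sigma) @^-1` A).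
Proof.
rewrite trip_costE total_costE => le_cost.
have fin12 : (\int[P]_x travel_cost w12 (t1_of x) (t2_of x))%E \is a fin_num.
  by rewrite ge0_fin_numE// integral_ge0// => x _; exact: travel_cost_ge0.
have fin01 : (\int[P]_x travel_cost w01 (t0_of x) (t1_of x))%E \is a fin_num.
  by rewrite ge0_fin_numE// integral_ge0// => x _; exact: travel_cost_ge0.
have ge12 : (\int[P]_x travel_cost w12 (t1_of x) (t2_of x) <=
    \int[P]_x travel_cost w12 (t1_of x) (arrival sigma (t1_of x)))%E.
  rewrite -(@leeD2lE _ (\int[P]_x travel_cost w01 (t0_of x) (t1_of x))%E)//.
  by apply: (le_trans le_cost); rewrite leeD2r.
have ge01 : (\int[P]_x travel_cost w01 (t0_of x) (t1_of x) <=
    \int[P]_x travel_cost w01 (departure sigma (t1_of x)) (t1_of x))%E.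
  rewrite -(@leeD2rE _ (\int[P]_x travel_cost w12 (t1_of x) (t2_of x))%E)//.
  by apply: (le_trans le_cost); rewrite leeD2l.
have eq12 : P [set x | t2_of x != arrival sigma (t1_of x)] = 0%E.
  apply: (monotone_rearrangement_eq hw12) ge12 => //.
  - exact: measurable_t1.
  - exact: measurable_t2.
  - exact: arrival_nd.
  - exact: law_arrival.
  - exact: crossing_atomless.
have eq01 : P [set x | - t0_of x != - departure sigma (- - t1_of x)] = 0%E.
  apply: (@monotone_rearrangement_eq _ _ _ P w01 (fun x => - t1_of x)
    (fun x => - t0_of x) (fun y => - departure sigma (- y))) => //.
  - move=> y; rewrite -(crossing_atomless (- y)); congr (P _).
    by apply/seteqP; split => x/=; [move=> <-|move=> ->]; rewrite opprK.
  - by under eq_integral do rewrite travel_costN.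
  - under eq_integral do rewrite travel_costN.
    by under [in leRHS]eq_integral => x _
      do rewrite (opprK (t1_of x)) travel_costN.
move=> A mA.
pose g x := through (departure sigma) (arrival sigma) (@t1_of R x).
have mg : measurable_fun setT g.
  by apply: measurableT_comp; [exact: measurable_through|exact: measurable_t1].
(* Off this null set a point is determined by its crossing time. The signs come from the time
   reversal on the first edge. *)
pose N := [set x | - t0_of x != - departure sigma (- - t1_of x)] `|`
          [set x | @t2_of R x != arrival sigma (t1_of x)].
have mD : measurable_fun setT (fun x => - departure sigma (- - @t1_of R x)).
  by apply: (measurableT_comp (nondecreasing_measurable _ departureN_nd)).
have mAr : measurable_fun setT (fun x => arrival sigma (@t1_of R x)).
  apply: (measurableT_comp
    (nondecreasing_measurable _ (@arrival_nd sigma))) => //.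
  exact: measurable_t1.
have mneq (f h : times R -> R) :
    measurable_fun setT f -> measurable_fun setT h ->
    measurable [set x | f x != h x].
  move=> mf mh.
  rewrite (_ : [set x | _] =
    [set x | f x < h x] `|` [set x | h x < f x]); last first.
    by apply/seteqP; split => x/=; rewrite neq_lt => /orP.
  by apply: measurableU; rewrite -[X in measurable X]setTI;
    exact: measurable_fun_ltr.
have mN_ : measurable N.
  by apply: measurableU; apply: mneq => //; exact: measurable_t2.
have PN : P N = 0%E.
  by rewrite /N measureU0//; apply: mneq => //; exact: measurable_t2.
have gE x : ~ N x -> g x = x.
  rewrite /N/= => /not_orP[/negP]; rewrite negbK eqr_opp.
  rewrite (opprK (t1_of x)) => /eqP t0E.
  by move=> /negP; rewrite negbK => /eqP t2E; case: x t0E t2E => -[x0 x1] x2;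
    rewrite /g /through /t0_of /t1_of /t2_of /= => -> ->.
have -> : sigma (through (departure sigma) (arrival sigma) @^-1` A) =
    P (g @^-1` A).
  by [].
have mgA : measurable (g @^-1` A).
  by rewrite -[X in measurable X]setTI; exact: mg.
have negl (B : set (times R)) : measurable B -> P B = P (B `\` N).
  move=> mB; have -> : P (B `\` N) = (P B - P (B `&` N))%E.
    by rewrite measureD// (le_lt_trans (probability_le1 _ _)) ?ltry.
  have -> : P (B `&` N) = 0%E.
    apply/eqP; rewrite eq_le measure_ge0 andbT -[leRHS]PN le_measure ?inE//.
    exact: measurableI.
  by rewrite sube0.
rewrite -[LHS]/(P A) negl// [RHS]negl//; congr (P _).
by apply/seteqP; split => x [Ax Nx]; split => //;
  move: Ax; rewrite /preimage/= gE.
Qed.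
End finite_cost.

Lemma trip_cost_le : (trip_cost q <= total_cost w01 w12 pi)%E.
Proof.
have [|] := ltP (total_cost w01 w12 pi) +oo%E; first exact: trip_cost_le_finite.
by rewrite leye_eq => /eqP ->; rewrite leey.
Qed.

End lower_bound.
End toll_station_problem.

(** * Lower limits and convexity of the edge cost *)

Section limn_einf_bounds.
Context (R : realType).
Implicit Types u v : (\bar R)^nat.

Lemma limn_einf_le u (M : \bar R) :
  (forall n, u n <= M)%E -> (limn_einf u <= M)%E.
Proof.
move=> uM; rewrite limn_einf_lim (cvg_lim _ (@cvg_einfs_sup R u))//.
apply: ub_ereal_sup => _ [n _ <-]; apply: le_trans (uM n).
by apply: ereal_inf_lbound; exists n => /=.
Qed.

Lemma limn_einf_ge (x : R^nat) (l : R) v : x n @[n --> \oo] --> l ->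
  (forall n, (x n)%:E <= v n)%E -> (l%:E <= limn_einf v)%E.
Proof.
move=> xl xv.
have /cvg_limn_einf_sup[<- _] : (EFin \o x) n @[n --> \oo] --> l%:E.
  by apply/cvg_EFin => //; exact: nearW.
rewrite !limn_einf_lim; apply: lee_lim; [exact: is_cvg_einfs..|].
apply: nearW => n; apply: le_ereal_inf_tmp => _ [k /= nk <-].
apply: (le_trans _ (xv k)).
by apply: ereal_inf_lbound; exists k.
Qed.

End limn_einf_bounds.

Section travel_cost_convexity.
Context (R : realType) (w : R).
Hypothesis w0 : 0 < w.

(* w / z is the supremum over k of the affine functions w (2 k - k^2 z) *)
Lemma travel_cost_tangent (k y z : R) :
  ((w * (2 * k - k ^+ 2 * (z - y)))%:E <= travel_cost w y z)%E.
Proof.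
rewrite /travel_cost; case: ltP => [yz|_]; last by rewrite leey.
rewrite lee_fin ler_pM2l//.
have d0 : 0 < z - y by rewrite subr_gt0.
rewrite -subr_ge0 (_ : _ - _ = (k * (z - y) - 1) ^+ 2 / (z - y)).
  by rewrite divr_ge0 ?sqr_ge0// ltW.
by field; rewrite gt_eqF.
Qed.

Lemma travel_cost_attained (y z : R) : y < z ->
  travel_cost w y z = (w * (2 * (z - y)^-1 - (z - y)^-1 ^+ 2 * (z - y)))%:E.
Proof.
move=> yz; rewrite /travel_cost yz; congr EFin.
have d0 : 0 < z - y by rewrite subr_gt0.
by field; rewrite gt_eqF.
Qed.

Lemma travel_cost_unbounded (y z M : R) : z <= y ->
  exists2 k, 0 < k & M <= w * (2 * k - k ^+ 2 * (z - y)).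
Proof.
(* Here [w * k] is [|M| + 1], already above [M]; the quadratic term only helps because [z <= y]. *)
move=> zy; exists ((`|M| + 1) / w); first by rewrite divr_gt0// ltr_wpDl.
set k := _ / w.
have k0 : 0 <= k by rewrite divr_ge0 ?addr_ge0// ltW.
rewrite (@le_trans _ _ (w * k))//.
  rewrite /k mulrCA divff ?gt_eqF// mulr1 (le_trans (ler_norm M))//.
  by rewrite lerDl.
rewrite ler_pM2l//.
have : 0 <= k ^+ 2 * (y - z) by rewrite mulr_ge0 ?sqr_ge0// subr_ge0.
by rewrite -opprB mulrN; lra.
Qed.

(** Midpoint convexity of [w / d] in the travel time [d], doubled to stay clear of divisions in the
    extended reals. The defect is a square over a positive denominator, so equality at finite cost
    means equal travel times. *)
Lemma travel_cost_mid (y z y' z' : R) :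
  (travel_cost w ((y + y') / 2) ((z + z') / 2) +
   travel_cost w ((y + y') / 2) ((z + z') / 2) <=
   travel_cost w y z + travel_cost w y' z')%E /\
  ((travel_cost w y z + travel_cost w y' z' <=
    travel_cost w ((y + y') / 2) ((z + z') / 2) +
    travel_cost w ((y + y') / 2) ((z + z') / 2))%E ->
   (travel_cost w y z + travel_cost w y' z' < +oo)%E -> z - y = z' - y').
Proof.
have ninf (u v : R) : travel_cost w u v != -oo%E.
  by rewrite gt_eqF// (lt_le_trans _ (travel_cost_ge0 u v w0))// ltNyr.
have [yz|zy] := ltP y z; last first.
  by rewrite [travel_cost w y z]/travel_cost ltNge zy/= addye// ?leey ?ltxx.
have [yz'|zy'] := ltP y' z'; last first.
  by rewrite [travel_cost w y' z']/travel_cost ltNge zy'/= addey// ?leey ?ltxx.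
rewrite /travel_cost yz yz' (_ : _ / 2 < _ / 2); last by lra.
rewrite -!EFinD !lee_fin.
have d0 : 0 < z - y by rewrite subr_gt0.
have d0' : 0 < z' - y' by rewrite subr_gt0.
set d := z - y in d0 *; set d' := z' - y' in d0' *.
have -> : (z + z') / 2 - (y + y') / 2 = (d + d') / 2 by rewrite /d /d'; field.
have E : w / d + w / d' - (w / ((d + d') / 2) + w / ((d + d') / 2)) =
   w * ((d - d') ^+ 2 / (d * d' * (d + d'))).
  by field; rewrite !gt_eqF//; lra.
have K0 : 0 < d * d' * (d + d') by rewrite !mulr_gt0// addr_gt0.
split.
  by rewrite -subr_ge0 E mulr_ge0 ?(ltW w0)// divr_ge0 ?sqr_ge0// ltW.
rewrite -subr_le0 E pmulr_rle0// ler_pdivrMr// mul0r => h _.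
have : (d - d') ^+ 2 == 0 by rewrite eq_le h sqr_ge0.
by rewrite sqrf_eq0 subr_eq0 => /eqP.
Qed.

End travel_cost_convexity.

(** * Stability of the spread condition under lattice operations, midpoints and limits *)

Section spread_closure.
Context (R : realType) (tf r : R).

Lemma spread_min q q' : spread tf r q -> spread tf r q' ->
  spread tf r (fun s => Num.min (q s) (q' s)).
Proof.
move=> [nd1 i1 s1] [nd2 i2 s2]; split.
- by move=> s s' ss'; rewrite le_min !ge_min nd1// nd2// orbT.
- by move=> s; have := i1 s; have := i2 s; case: (leP (q s) (q' s)).
- move=> s s' s0 ss' s'1; have := s1 _ _ s0 ss' s'1; have := s2 _ _ s0 ss' s'1.
  by case: (leP (q s) (q' s)) => h; case: (leP (q s') (q' s')) => h'; lra.
Qed.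

Lemma spread_max q q' : spread tf r q -> spread tf r q' ->
  spread tf r (fun s => Num.max (q s) (q' s)).
Proof.
move=> [nd1 i1 s1] [nd2 i2 s2]; split.
- by move=> s s' ss'; rewrite ge_max !le_max nd1// nd2// orbT.
- by move=> s; have := i1 s; have := i2 s; case: (leP (q s) (q' s)).
- move=> s s' s0 ss' s'1; have := s1 _ _ s0 ss' s'1; have := s2 _ _ s0 ss' s'1.
  by case: (leP (q s) (q' s)) => h; case: (leP (q s') (q' s')) => h'; lra.
Qed.

Lemma spread_mid q q' : spread tf r q -> spread tf r q' ->
  spread tf r (fun s => (q s + q' s) / 2).
Proof.
move=> [nd1 i1 s1] [nd2 i2 s2]; split.
- by move=> s s' ss'; have := nd1 _ _ ss'; have := nd2 _ _ ss'; lra.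
- by move=> s; have := i1 s; have := i2 s; lra.
- move=> s s' s0 ss' s'1.
  by have := s1 _ _ s0 ss' s'1; have := s2 _ _ s0 ss' s'1; lra.
Qed.

Lemma spread_lim (q_ : nat -> R -> R) q : (forall n, spread tf r (q_ n)) ->
  (forall s, q_ n s @[n --> \oo] --> q s) -> spread tf r q.
Proof.
move=> qs ql; split.
- move=> s s' ss'; apply: (ler_cvg_to (ql s) (ql s')).
  by apply: nearW => n; have [nd _ _] := qs n; exact: nd.
- move=> s; apply/andP; split.
    apply: (ler_cvg_to (cvg_cst 0) (ql s)); apply: nearW => n.
    by have [_ /(_ s)/andP[]] := qs n.
  apply: (ler_cvg_to (ql s) (cvg_cst tf)); apply: nearW => n.
  by have [_ /(_ s)/andP[]] := qs n.
- move=> s s' s0 ss' s'1.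
  apply: (ler_cvg_to (cvgD (ql s) (cvg_cst _)) (ql s')).
  by apply: nearW => n; have [_ _ h] := qs n; exact: h.
Qed.

End spread_closure.

(** * Existence and uniqueness of the optimal crossing quantile *)

Section optimal_spread.
Context (R : realType) (tf r w01 w12 : R).
Variables (mu0 muT : probability (measurableTypeR R) R).
Hypotheses (tf0 : 0 < tf) (hw01 : 0 < w01) (hw12 : 0 < w12).

Local Notation J := (trip_cost tf w01 w12 mu0 muT).
Local Notation c := (cost w01 w12).
Local Notation trip := (trip tf mu0 muT).

Lemma measurable_cost_trip q : spread tf r q ->
  measurable_fun setT (fun s => c (trip q s)).
Proof.
move=> qs; apply: measurableT_comp; first exact: measurable_cost.
exact: (measurable_trip mu0 muT tf0 qs).
Qed.

Lemma trip_cost_ge0 q : (0 <= J q)%E.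
Proof. by apply: integral_ge0 => s _; exact: cost_ge0. Qed.

(** The cost at level [s] sees only the value at [s], and minimum and maximum merely reorder the two
    values there. *)
Lemma trip_cost_lattice q q' : spread tf r q -> spread tf r q' ->
  (J (fun s => Num.min (q s) (q' s)) + J (fun s => Num.max (q s) (q' s)) =
   J q + J q')%E.
Proof.
move=> qs qs'; rewrite /trip_cost.
rewrite -ge0_integralD//; last 4 first.
- by move=> s _; exact: cost_ge0.
- by apply: measurable_cost_trip; exact: spread_min.
- by move=> s _; exact: cost_ge0.
- by apply: measurable_cost_trip; exact: spread_max.
rewrite -ge0_integralD//; last 4 first.
- by move=> s _; exact: cost_ge0.
- exact: measurable_cost_trip.
- by move=> s _; exact: cost_ge0.
- exact: measurable_cost_trip.
apply: eq_integral => s _; rewrite /trip.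
by case: (leP (q s) (q' s)) => _ //; rewrite addeC.
Qed.

(** The affine minorants of the edge costs pass to the limit. They attain the cost at ordered times
    and are unbounded at unordered ones. *)
Lemma cost_trip_lsc (q_ : nat -> R -> R) q s : q_ n s @[n --> \oo] --> q s ->
  (c (trip q s) <= limn_einf (fun n => c (trip (q_ n) s)))%E.
Proof.
move=> ql; rewrite costE.
set u := fun n => _.
set y0 := t0_of _; set y1 := t1_of _; set y2 := t2_of _.
have affine_le k l : ((w01 * (2 * k - k ^+ 2 * (y1 - y0)) +
    w12 * (2 * l - l ^+ 2 * (y2 - y1)))%:E <= limn_einf u)%E.
  apply: (@limn_einf_ge _ (fun n => w01 * (2 * k - k ^+ 2 * (q_ n s - y0)) +
    w12 * (2 * l - l ^+ 2 * (y2 - q_ n s)))).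
    apply: cvgD; apply: cvgMr; apply: cvgB; try exact: cvg_cst; apply: cvgMr.
      by apply: cvgB => //; exact: cvg_cst.
    by apply: cvgB => //; exact: cvg_cst.
  by move=> n; rewrite /u costE EFinD; apply: leeD; exact: travel_cost_tangent.
have [y01|y10] := ltP y0 y1; have [y12|y21] := ltP y1 y2.
- by rewrite !travel_cost_attained// -EFinD.
- suff -> : limn_einf u = +oo%E by rewrite leey.
  apply/eq_infty => M.
  have [l l0 Ml] := travel_cost_unbounded hw12 M y21.
  (* The parameter 0 switches off the minorant of the other edge. *)
  apply: le_trans (affine_le 0 l); rewrite lee_fin.
  by rewrite mulr0 expr0n/= mul0r subrr mulr0 add0r.
- suff -> : limn_einf u = +oo%E by rewrite leey.
  apply/eq_infty => M.
  have [k k0 Mk] := travel_cost_unbounded hw01 M y10.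
  apply: le_trans (affine_le k 0); rewrite lee_fin.
  by rewrite mulr0 expr0n/= mul0r subrr mulr0 addr0.
- suff -> : limn_einf u = +oo%E by rewrite leey.
  apply/eq_infty => M.
  have [k k0 Mk] := travel_cost_unbounded hw01 M y10.
  apply: le_trans (affine_le k 0); rewrite lee_fin.
  by rewrite mulr0 expr0n/= mul0r subrr mulr0 addr0.
Qed.

(** Fatou's lemma combined with the pointwise lower semicontinuity [cost_trip_lsc]. *)
Lemma trip_cost_lim (q_ : nat -> R -> R) q M : (forall n, spread tf r (q_ n)) ->
  (forall s, q_ n s @[n --> \oo] --> q s) -> (forall n, J (q_ n) <= M)%E ->
  (J q <= M)%E.
Proof.
move=> qs ql qM; apply: (le_trans _ (limn_einf_le qM)).
apply: le_trans (fatou _ _ _ _) => //.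
- apply: ge0_le_integral => //.
  + by move=> s _; exact: cost_ge0.
  + exact: measurable_cost_trip (spread_lim qs ql).
  + apply: (emeasurable_fun_cvg
      (fun n s => einfs (fun k => c (trip (q_ k) s)) n)) => [n|s _].
      by apply: measurable_fun_einfs => k; exact: measurable_cost_trip.
    by rewrite limn_einf_lim; exact: is_cvg_einfs.
  + by move=> s _; exact: cost_trip_lsc.
- by move=> n; exact: measurable_cost_trip.
- by move=> n s _; exact: cost_ge0.
Qed.

Lemma exists_optimal_spread : (exists2 q, spread tf r q & (J q < +oo)%E) ->
  exists2 q, spread tf r q & forall q', spread tf r q' -> (J q <= J q')%E.
Proof.
move=> [q1 q1s q1oo].
pose S := [set e | exists2 q, spread tf r q & e = J q].
have S_lb : (0 <= ereal_inf S)%E.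
  by apply: le_ereal_inf_tmp => _ [q _ ->]; exact: trip_cost_ge0.
have S_fin : ereal_inf S \is a fin_num.
  rewrite ge0_fin_numE//; apply: le_lt_trans q1oo.
  by apply: ereal_inf_lbound; exists q1.
pose m := fine (ereal_inf S).
have mE : ereal_inf S = m%:E by rewrite fineK.
have mJ q : spread tf r q -> (m%:E <= J q)%E.
  by move=> qs; rewrite -mE; apply: ereal_inf_lbound; exists q.
(* Geometric errors are summable, so the excesses accumulated from index [n] on tend to 0. *)
have /choice[q qP] n : exists q, spread tf r q /\ (J q <= (m + 2^-1 ^+ n)%:E)%E.
  have e0 : 0 < (2^-1 : R) ^+ n by rewrite exprn_gt0.
  have [_ [q qs ->] /ltW Jq] := lb_ereal_inf_adherent e0 S_fin.
  by exists q; rewrite EFinD -mE.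
(* [p n k] is the pointwise minimum of [q n], ..., [q (n + k)]. *)
pose p := fix p n k s :=
  if k is k'.+1 then Num.min (p n k' s) (q (n + k)%N s) else q n s.
have ps n k : spread tf r (p n k).
  elim: k => [|k IH]; first by have [] := qP n.
  by apply: spread_min => //; have [] := qP (n + k.+1)%N.
(* The maximum costs at least [m], so by the lattice identity a further minimum adds only the excess
   of the new term. The bound is [m] plus the geometric sum of the errors from [n] to [n + k]. *)
have pJ n k : (J (p n k) <= (m + 2 * 2^-1 ^+ n - 2^-1 ^+ (n + k))%:E)%E.
  elim: k => [|k IH].
    have [_ h] := qP n; apply: (le_trans h); rewrite lee_fin addn0.
    by lra.
  have [qs Jq] := qP (n + k.+1)%N.
  rewrite -(@leeD2rE _ m%:E)//.
  have le1 : (J (p n k.+1) + m%:E <= J (p n k) + J (q (n + k.+1)%N))%E.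
    rewrite -trip_cost_lattice//; apply: leeD => //.
    by apply: mJ; exact: spread_max.
  apply: (le_trans le1); apply: (le_trans (leeD IH Jq)).
  rewrite -!EFinD lee_fin addnS exprS; set e := _ ^+ (n + k).
  by lra.
pose l n s := inf (range (fun k => p n k s)).
have p_ni n s : nonincreasing_seq (fun k => p n k s).
  by apply/nonincreasing_seqP => k /=; rewrite ge_min lexx.
have p_lb n s : has_lbound (range (fun k => p n k s)).
  by exists 0 => _ [k _ <-]; have [_ /(_ s)/andP[]] := ps n k.
have pl n s : p n k s @[k --> \oo] --> l n s by exact: nonincreasing_cvgn.
have ls n : spread tf r (l n) by apply: spread_lim (pl n); exact: ps.
have lJ n : (J (l n) <= (m + 2 * 2^-1 ^+ n)%:E)%E.
  apply: (trip_cost_lim (ps n) (pl n)) => k; apply: (le_trans (pJ n k)).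
  by rewrite lee_fin gerBl exprn_ge0.
(* Both minima end at the same index, and the left one includes the additional term [q n]. *)
have p_shift n k s : p n k.+1 s <= p n.+1 k s.
  elim: k => [|k IH]; first by rewrite /= addn1 ge_min lexx orbT.
  rewrite [leLHS]/= [leRHS]/= le_min !ge_min.
  rewrite /= ge_min in IH; rewrite addSnnS lexx !orbT andbT.
  by rewrite IH.
have l_nd s : nondecreasing_seq (fun n => l n s).
  apply/nondecreasing_seqP => n; apply: lb_le_inf.
    by exists (p n.+1 0 s); exists 0%N.
  move=> _ [k _ <-]; apply: le_trans (p_shift n k s).
  by apply: ge_inf => //; exists k.+1.
(* [z] is the pointwise lower limit of the minimising sequence [q]. *)
pose z s := sup (range (fun n => l n s)).
have lz s : l n s @[n --> \oo] --> z s.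
  apply: nondecreasing_cvgn => //.
  by exists tf => _ [n _ <-]; have [_ /(_ s)/andP[]] := ls n.
exists z; first exact: spread_lim lz.
move=> q' q's; apply: le_trans (mJ _ q's).
apply/lee_addgt0Pr => e e0.
have [N hN] : exists N, 2 * (2^-1 : R) ^+ N <= e.
  have : 2 * (2^-1 : R) ^+ n @[n --> \oo] --> (2 * 0 : R).
    by apply: cvgMr; apply: cvg_expr; rewrite gtr0_norm// invf_lt1// ltr1n.
  rewrite mulr0 => /cvgrPdist_le/(_ e e0)[N _ hN].
  exists N; have := hN N (leqnn N).
  by rewrite sub0r normrN ger0_norm// mulr_ge0// exprn_ge0.
(* Dropping the first [N] terms keeps the limit and brings every excess below [e]. *)
apply: (@trip_cost_lim (fun n => l (n + N)%N)) => //.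
- by move=> s; rewrite (cvg_shiftn N (fun n => l n s)).
- move=> n; apply: (le_trans (lJ _)); rewrite -EFinD lee_fin lerD2l.
  apply: le_trans hN; rewrite ler_pM2l// exprD ger_pMl ?exprn_gt0//.
  by rewrite exprn_ile1// invf_le1// ler1n.
Qed.

(** The midpoint of two optima is admissible, so convexity can be strict only on a null set of
    levels. *)
Lemma optimal_spread_unique q q' : spread tf r q -> spread tf r q' ->
  (J q < +oo)%E -> (J q' <= J q)%E ->
  (forall p, spread tf r p -> (J q <= J p)%E) ->
  {ae unit_law R, forall s, q s = q' s}.
Proof.
move=> qs qs' qoo q'q qmin.
pose p s := (q s + q' s) / 2.
have pspread : spread tf r p by exact: spread_mid.
pose f s := (c (trip p s) + c (trip p s))%E.
pose g s := (c (trip q s) + c (trip q' s))%E.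
have mid s : (f s <= g s)%E /\ ((g s <= f s)%E -> (g s < +oo)%E -> q s = q' s).
  rewrite /f /g !costE /trip/= /t0_of /t1_of /t2_of/=.
  set y0 := quantile _ mu0 s; set y2 := quantile _ muT s.
  have := travel_cost_mid hw01 y0 (q s) y0 (q' s).
  have := travel_cost_mid hw12 (q s) y2 (q' s) y2.
  have half (y : R) : (y + y) / 2 = y by field.
  rewrite !half -/(p s).
  rewrite (addeACA (travel_cost w01 y0 (p s))).
  rewrite (addeACA (travel_cost w01 y0 (q s))).
  have A0 (y z : R) : (0 <= travel_cost w01 y z)%E by exact: travel_cost_ge0.
  have B0 (y z : R) : (0 <= travel_cost w12 y z)%E by exact: travel_cost_ge0.
  move=> [leB _] [leA eqA]; split; first exact: leeD.
  move=> ge_mid lt_oo.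
  have A12oo : (travel_cost w01 y0 (q s) + travel_cost w01 y0 (q' s) < +oo)%E.
    by apply: le_lt_trans lt_oo; rewrite leeDl// adde_ge0.
  have B12fin :
      (travel_cost w12 (q s) y2 + travel_cost w12 (q' s) y2)%E \is a fin_num.
    rewrite ge0_fin_numE ?adde_ge0//.
    by apply: le_lt_trans lt_oo; rewrite leeDr// adde_ge0.
  (* Both trips leave at [y0], so equal travel times on the first edge already give equal crossing
     times. *)
  apply: (addIr (- y0)); apply: eqA => //.
  rewrite -(leeD2rE _ _ B12fin); apply: (le_trans ge_mid).
  by rewrite leeD2l.
have f0 s : (0 <= f s)%E by rewrite adde_ge0// cost_ge0.
have g0 s : (0 <= g s)%E by rewrite adde_ge0// cost_ge0.
have mf : measurable_fun setT f.
  by apply: emeasurable_funD; exact: measurable_cost_trip.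
have mg : measurable_fun setT g.
  by apply: emeasurable_funD; exact: measurable_cost_trip.
have ifE : (\int[unit_law R]_s f s = J p + J p)%E.
  by rewrite ge0_integralD//; try exact: measurable_cost_trip;
    move=> s _; exact: cost_ge0.
have igE : (\int[unit_law R]_s g s = J q + J q')%E.
  by rewrite ge0_integralD//; try exact: measurable_cost_trip;
    move=> s _; exact: cost_ge0.
have igoo : (\int[unit_law R]_s g s < +oo)%E.
  by rewrite igE lte_add_pinfty// (le_lt_trans q'q).
have [N1 [mN1 N10 fgN1]] : ae_eq (unit_law R) setT f g.
  apply: ge0_integral_squeeze => //.
  - by move=> s; have [] := mid s.
  - apply: le_lt_trans igoo; apply: ge0_le_integral => // s _.
    by have [] := mid s.
  - by rewrite ifE igE; apply: leeD; [|apply: (le_trans q'q)]; exact: qmin.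
have ig : (unit_law R).-integrable setT g.
  by apply/integrableP; split => //; under eq_integral do rewrite gee0_abs//.
have [N2 [mN2 N20 gN2]] := integrable_ae measurableT ig.
exists (N1 `|` N2); split; first exact: measurableU.
  by rewrite measureU0.
apply: subset_trans (setUSS fgN1 gN2) => s /= qq'.
have [nfg|] := pselect (~ (setT s -> f s = g s)); first by left.
move=> /contrapT/(_ I) fg; right => /(_ I) gfin; apply: qq'.
have [_] := mid s; apply; first by rewrite fg.
by rewrite -ge0_fin_numE.
Qed.

End optimal_spread.

(** The Radon-Nikodym derivative exceeds [r] only on a null set: on [B] it lies strictly above [r],
    yet [sigma B] is at most [r] times the length of [B]. Truncation at [r] then makes the bound
    hold everywhere. *)
Lemma bounded_density (R : realType) (tf r : R)
    (sigma : probability (measurableTypeR R) R) : 0 < r ->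
  sigma `[0, tf]%classic = 1%E ->
  (forall A, measurable A -> (sigma A <= r%:E * lebesgue_measure A)%E) ->
  exists s : R -> R,
    [/\ measurable_fun [set: measurableTypeR R] s,
        forall t, 0 <= s t <= r &
        forall A, measurable A -> sigma A = density_measure tf s A].
Proof.
move=> r0 sigma1 sigma_le.
have dom : sigma `<< (@lebesgue_measure R).
  apply/null_content_dominatesP => A mA A0.
  apply/eqP; rewrite eq_le measure_ge0 andbT.
  by have := sigma_le _ mA; rewrite A0 mule0.
pose f : measurableTypeR R -> \bar R :=
  Radon_Nikodym_SigmaFinite.f sigma (@lebesgue_measure R).
have f0 t : (0 <= f t)%E by exact: Radon_Nikodym_SigmaFinite.f_ge0.
have ffin t : f t \is a fin_num by exact: Radon_Nikodym_SigmaFinite.f_fin_num.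
have fint A : measurable A -> sigma A = (\int[lebesgue_measure]_(t in A) f t)%E.
  by move=> mA; exact: Radon_Nikodym_SigmaFinite.f_integral.
have mf : measurable_fun setT f.
  by have /measurable_int := Radon_Nikodym_SigmaFinite.f_integrable dom.
pose B := [set t | (r%:E < f t)%E].
have mB : measurable B.
  by rewrite -[X in measurable X]setTI; exact: emeasurable_fun_o_infty.
have B0 : lebesgue_measure B = 0%E.
  have rBE : (\int[lebesgue_measure]_t (r%:E * (\1_B t)%:E) =
      r%:E * lebesgue_measure B)%E.
    by rewrite ge0_integralZl//= ?integral_indic//= ?setIT//;
      [apply/measurable_EFinP|rewrite lee_fin ltW].
  have fBE : (\int[lebesgue_measure]_t (f t * (\1_B t)%:E) = sigma B)%E.
    rewrite fint// [RHS]integral_mkcond; apply: eq_integral => t _.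
    by rewrite patchE indicE; case: ifP => tB; rewrite ?mule1 ?mule0.
  have m1 : measurable_fun setT
      (fun t : measurableTypeR R => r%:E * (\1_B t)%:E)%E.
    by apply: emeasurable_funM => //; apply/measurable_EFinP.
  have m2 : measurable_fun setT
      (fun t : measurableTypeR R => f t * (\1_B t)%:E)%E.
    by apply: emeasurable_funM => //; apply/measurable_EFinP.
  have n1 t : (0 <= r%:E * (\1_B t)%:E)%E.
    by rewrite mule_ge0// ?lee_fin// ltW.
  have le12 t : (r%:E * (\1_B t)%:E <= f t * (\1_B t)%:E)%E.
    rewrite indicE; case: (boolP (t \in B)) => tB; rewrite ?mule0// !mule1.
    by apply: ltW; move: tB; rewrite inE.
  have oo1 : (\int[lebesgue_measure]_t (r%:E * (\1_B t)%:E) < +oo)%E.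
    apply: (@le_lt_trans _ _ (sigma B)).
      rewrite -fBE; apply: ge0_le_integral => //.
    by rewrite (le_lt_trans (probability_le1 _ _)) ?ltry.
  have [N [mN N0 hN]] : ae_eq lebesgue_measure (setT : set (measurableTypeR R))
      (fun t => r%:E * (\1_B t)%:E)%E (fun t => f t * (\1_B t)%:E)%E.
    apply: ge0_integral_squeeze => //.
    by rewrite fBE rBE; exact: sigma_le.
  apply/eqP; rewrite eq_le measure_ge0 andbT -[leRHS]N0 le_measure ?inE//.
  move=> t Bt; apply: hN => /= /(_ I); rewrite indicE mem_set// !mule1 => rf.
  by move: Bt; rewrite /B/= -rf ltxx.
pose s t := Num.min (fine (f t)) r.
have ms : measurable_fun [set: measurableTypeR R] s.
  apply: measurable_minr => //.
  by apply: measurableT_comp => //; exact: measurable_fine.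
exists s; split => //.
  move=> t; rewrite /s ge_min lexx orbT andbT le_min (ltW r0) andbT.
  exact: fine_ge0.
move=> A mA.
have mIA : measurable (`[0, tf]%classic `&` A : set (measurableTypeR R)).
  exact: measurableI.
have -> : sigma A = sigma (`[0, tf]%classic `&` A).
  have E : A = (`[0, tf]%classic `&` A) `|` (A `\` `[0, tf]%classic).
    by rewrite setIC setUIDK.
  rewrite {1}E measureU0//; first exact: measurableD.
  apply/eqP; rewrite eq_le measure_ge0 andbT.
  have : sigma (~` `[0, tf]%classic) = 0%E.
    by rewrite probability_setC// sigma1 subee.
  move=> sc; rewrite -[leRHS]sc le_measure ?inE//.
  - exact: measurableD.
  - exact: measurableC.
rewrite fint// /density_measure.
apply: ge0_ae_eq_integral => //.
- exact: measurable_funTS.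
- by apply: measurable_funTS; apply/measurable_EFinP.
- by move=> t _; rewrite lee_fin /s le_min (ltW r0) andbT fine_ge0.
- exists B; split => // t/=; apply: contra_notP => /negP.
  rewrite -leNgt => fr _; rewrite /s min_l ?fineK//.
  by rewrite -lee_fin fineK.
Qed.

(** [hfin] excludes the degenerate cases of no feasible plan, or of all costs being [+oo], when
    every feasible plan is a minimizer. The maps come out nondecreasing, not non-increasing as in
    the informal wording: the edge costs are convex in the travel time, so later crossings pair with
    later departures and arrivals. *)
Theorem theorem1 (R : realType) (tf r w01 w12 : R)
    (mu0 muT : probability (measurableTypeR R) R)
    (htf : 0 < tf) (hr : 0 < r) (hw01 : 0 < w01) (hw12 : 0 < w12)
    (hmu0 : mu0 `[0, tf]%classic = 1%E) (hmuT : muT `[0, tf]%classic = 1%E)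
    (hfin : exists2 pi : {measure set (times R) -> \bar R},
        feasible tf r mu0 muT pi & (total_cost w01 w12 pi < +oo)%E) :
  exists pi : {measure set (times R) -> \bar R},
    [/\ minimizer tf r w01 w12 mu0 muT pi,
        forall pi' : {measure set (times R) -> \bar R},
          minimizer tf r w01 w12 mu0 muT pi' ->
          forall A : set (times R), measurable A -> pi' A = pi A
      & exists TD TA sigma : R -> R,
          [/\ {in `[0, tf] &, nondecreasing_fun TD},
              {in `[0, tf] &, nondecreasing_fun TA},
              measurable_fun (`[0, tf]%classic : set (measurableTypeR R)) sigma
                /\ (forall t : R, t \in `[0, tf] -> 0 <= sigma t <= r),
              forall A : set (measurableTypeR R), measurable A ->
                pushforward pi t1_of A = density_measure tf sigma A
            & forall A : set (times R), measurable A ->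
                pi A = pushforward (density_measure tf sigma)
                         (through TD TA) A]].
Proof.
pose J := trip_cost tf w01 w12 mu0 muT.
have lower pi (pi_feas : feasible tf r mu0 muT pi) :=
  trip_cost_le htf hr hw01 hw12 hmu0 hmuT pi_feas.
have [q qs qmin] : exists2 q, spread tf r q &
    forall q', spread tf r q' -> (J q <= J q')%E.
  have [pi pi_feas pi_oo] := hfin.
  apply: exists_optimal_spread => //.
  exists (quantile tf (crossing pi_feas)).
    exact: crossing_spread.
  exact: le_lt_trans (lower _ pi_feas) pi_oo.
have qoo : (J q < +oo)%E.
  have [pi pi_feas pi_oo] := hfin.
  apply: le_lt_trans pi_oo; apply: le_trans (lower _ pi_feas).
  exact/qmin/crossing_spread.
pose sigma := law (unit_law R) (measurable_spread qs).
pose TD := departure tf mu0 sigma.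
pose TA := arrival tf muT sigma.
(* The crossing quantile of such a plan is itself optimal, hence almost everywhere [q], so its
   crossing law is [sigma]. This yields both uniqueness and the push-forward formula. *)
have optimal pi : feasible tf r mu0 muT pi ->
    (total_cost w01 w12 pi <= J q)%E ->
    forall A, measurable A -> pi A = sigma (through TD TA @^-1` A).
  move=> pi_feas pi_le A mA.
  pose q' := quantile tf (crossing pi_feas).
  have qs' : spread tf r q' by exact: crossing_spread.
  have q'q : (J q' <= J q)%E by exact: le_trans (lower _ pi_feas) pi_le.
  have qq' := optimal_spread_unique htf hw01 hw12 qs qs' qoo q'q qmin.
  have sigmaE B : measurable B -> crossing pi_feas B = sigma B.
    move=> mB; rewrite (crossing_quantile htf pi_feas mB) lawE.
    have [N [mN N0 hN]] := qq'.
    (* One inequality between preimages suffices, since the roles of [q] and [q'] can be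
       exchanged. *)
    have sub (f g : R -> R) : measurable_fun [set: measurableTypeR R] f ->
        measurable_fun [set: measurableTypeR R] g ->
        (forall s, f s <> g s -> N s) ->
        (unit_law R (f @^-1` B) <= unit_law R (g @^-1` B))%E.
      move=> mf mg fgN.
      have mfB : measurable (f @^-1` B : set (measurableTypeR R)).
        by rewrite -[X in measurable X]setTI; exact: mf.
      have mgB : measurable (g @^-1` B : set (measurableTypeR R)).
        by rewrite -[X in measurable X]setTI; exact: mg.
      apply: (@le_trans _ _ (unit_law R (g @^-1` B `|` N))).
        rewrite le_measure ?inE//; first exact: measurableU.
        move=> t Bft; have [fg|/fgN] := pselect (f t = g t); last by right.
        by left; rewrite /preimage/= -fg.
      by rewrite measureU0.
    have mq := measurable_spread qs; have mq' := measurable_spread qs'.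
    apply/le_anti/andP; split.
      by apply: sub => // t tN; apply: hN => /= /esym.
    by apply: sub => // t tN; exact: hN.
  have dfE : dfun (crossing pi_feas) = dfun sigma.
    by apply/funext => t; rewrite /dfun sigmaE.
  rewrite (feasible_through htf hr hw01 hw12 hmu0 hmuT (pi_feas := pi_feas))//.
  - rewrite sigmaE.
      by rewrite /TD /TA /departure /arrival dfE.
    rewrite -[X in measurable X]setTI.
    exact: (measurable_through mu0 muT htf (crossing pi_feas) measurableT mA).
  - exact: le_lt_trans pi_le qoo.
  - exact: le_trans pi_le (qmin _ qs').
pose pi := law (unit_law R) (measurable_trip mu0 muT htf qs).
have pi_feas : feasible tf r mu0 muT pi by exact: feasible_trip.
have pi_cost : total_cost w01 w12 pi = J q by exact: total_cost_law.
have pi_le : (total_cost w01 w12 pi <= J q)%E by rewrite pi_cost.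
have [s [ms s_itv sigma_s]] := bounded_density hr (law_spread_itv qs)
  (fun A mA => law_spread_le hr qs mA).
exists pi; split.
- split => // pi' pi'_feas; rewrite pi_cost; apply: le_trans (lower _ pi'_feas).
  exact/qmin/crossing_spread.
- move=> pi' [pi'_feas pi'_min] A mA.
  rewrite (optimal _ pi_feas)// (optimal _ pi'_feas)//.
  by rewrite -pi_cost; exact: pi'_min.
- exists TD, TA, s; split.
  + by move=> x y _ _; exact: departure_nd.
  + by move=> x y _ _; exact: arrival_nd.
  + by split; [exact: measurable_funTS|move=> t _; exact: s_itv].
  + by move=> A mA; rewrite -sigma_s.
  + move=> A mA; rewrite (optimal _ pi_feas)// sigma_s//.
    rewrite -[X in measurable X]setTI.
    exact: (measurable_through mu0 muT htf sigma measurableT mA).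
Qed.
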